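(* Let $f:[a,b]\times\mathbb{R}^n\times\mathbb{R}^m\to\mathbb{R}^n$ be continuously differentiable and Lipschitz-continuous with respect to both its second argument $x$ and its third argument $u$, and let $x_a\in\mathbb{R}^n$. Let $u^{*}\in PC([a,b];\mathbb{R}^m)$ be a control input and $x^{*}\in PC^1([a,b];\mathbb{R}^n)$ its associated state trajectory, i.e. the solution of $${}^{A}_{C}D^{\alpha,\beta}_{a+}x^{*}(t)=f(t,x^{*}(t),u^{*}(t)),\quad t\in[a,b],\qquad x^{*}(a)=x_a.$$ Let $h\in PC([a,b];\mathbb{R}^m)$ be a variation function and, for $\epsilon\in\mathbb{R}$, let $u^{\epsilon}(t)=u^{*}(t)+\epsilon h(t)$ for all $t\in[a,b]$. Let $x^{\epsilon}$ be the corresponding state trajectory, solution of $${}^{A}_{C}D^{\alpha,\beta}_{a+}x^{\epsilon}(t)=f(t,x^{\epsilon}(t),u^{\epsilon}(t)),\quad t\in[a,b],\qquad x^{\epsilon}(a)=x_a.$$ Then $x^{\epsilon}$ converges to $x^{*}$ when $\epsilon$ tends to zero, that is, $x^{\epsilon}(t)\to x^{*}(t)$ for all $t\in[a,b]$.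
   Context: $n,m\in\mathbb{N}$ with $m\le n$. $PC$ and $PC^1$ denote piecewise continuous and piecewise continuously differentiable functions. Let $[a,b]$ be a real interval, $\alpha\in[0,1]$ a real parameter, $\beta$ a complex parameter with non-negative real part, and $R$ a positive number with $R>(b-a)^{\mathrm{Re}(\beta)}$. Let $A$ be a complex analytic function on the disc $D(0,R)$, given there by the locally uniformly convergent power series $A(x)=\sum_{n=0}^{\infty}a_nx^n$. The left-sided fractional integral of order $\alpha$ with general analytic kernel $A$ is $${}^{A}I^{\alpha,\beta}_{a+}x(t)=\int_a^t(t-s)^{\alpha-1}A\bigl((t-s)^{\beta}\bigr)x(s)\,ds.$$ For an analytic function $A$ used in an operator of order $\alpha$, put $A_\Gamma(x)=\sum_{n\ge0}a_n\Gamma(\beta n+\alpha)x^n$. Let $\bar A(x)=\sum_{n\ge0}\bar a_nx^n$ be the analytic function with $A_\Gamma\cdot\bar A_\Gamma=1$, where, $\bar A$ being used in operators of order $1-\alpha$, $\bar A_\Gamma(x)=\sum_{n\ge0}\bar a_n\Gamma(\beta n+1-\alpha)x^n$. The left Caputo fractional derivative with general analytic kernel is ${}^{A}_{C}D^{\alpha,\beta}_{a+}x(t)={}^{\bar A}I^{1-\alpha,\beta}_{a+}x'(t)$, acting componentwise on vector-valued functions. *)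

(* Defs.v *)
From HB Require Import structures.
From mathcomp Require Export all_boot all_order all_algebra.
From mathcomp Require Export complex.
From mathcomp Require Export all_classical all_reals all_analysis.
Set Implicit Arguments.
Unset Strict Implicit.
Unset Printing Implicit Defensive.
Import Order.TTheory GRing.Theory Num.Theory.
Import numFieldNormedType.Exports.
Local Open Scope classical_set_scope.
Local Open Scope ring_scope.
Local Open Scope complex_scope.

(* t ^ z for real t > 0; the value at t = 0 only occurs on null sets below. *)
Definition cpow (R : realType) (t : R) (z : R[i]) : R[i] :=
  (t `^ complex.Re z)%:C *
  (cos (complex.Im z * ln t) +i* sin (complex.Im z * ln t)).

Definition cintegral (R : realType) (D : set R) (g : R -> R[i]) : R[i] :=
  (\int[lebesgue_measure]_(s in D) complex.Re (g s))
  +i* (\int[lebesgue_measure]_(s in D) complex.Im (g s)).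

Definition Gamma_int (R : realType) (z : R[i]) : R[i] :=
  cintegral `]0, +oo[ (fun t => cpow t (z - 1) * (expR (- t))%:C).

(* Off the right half-plane, Gamma z = Gamma (z + N) / (z (z+1) ... (z+N-1))
   with N least such that 0 < Re z + N.  Since x / 0 = 0, the poles
   0, -1, -2, ... get the value 0. *)
Definition Gamma (R : realType) (z : R[i]) : R[i] :=
  if 0 < complex.Re z then Gamma_int z
  else let N := (Num.truncn (- complex.Re z)).+1 in
       Gamma_int (z + N%:R) / \prod_(k < N) (z + k%:R).

(* A z = \sum_n a_n z ^ n, locally uniformly on the open disc of radius rho;
   R[i]^o is R[i] with the topology of the modulus. *)
Definition power_series_on (R : realType) (rho : R) (a : nat -> R[i])
    (A : R[i] -> R[i]) : Prop :=
  forall r : R, 0 < r < rho ->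
    {uniform [set z : R[i] | `|z| <= r%:C],
      (fun (N : nat) (z : R[i]) => (\sum_(k < N) a k * z ^+ k : R[i]^o)) @ \oo
      --> (A : R[i] -> R[i]^o)}.

(* The coefficients of A_Gamma for an operator of order alpha. *)
Definition Gamma_coef (R : realType) (alpha : R) (beta : R[i])
    (a : nat -> R[i]) (n : nat) : R[i] :=
  a n * Gamma (beta * n%:R + alpha%:C).

(* A_Gamma * Abar_Gamma = 1, where Abar is used in operators of order
   1 - alpha.  The radius of convergence of A_Gamma can be 0 (Gamma grows
   factorially), so this is the identity of power series given by the Cauchy
   product.  If alpha is 0 or 1, the coefficient of index n = 0 of one of the
   two factors involves the pole Gamma 0, so that this factor is not defined;
   as Gamma 0 = 0 here, the condition then fails. *)
Definition Gamma_inverse (R : realType) (alpha : R) (beta : R[i])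
    (a abar : nat -> R[i]) : Prop :=
  forall N : nat,
    \sum_(k < N.+1) Gamma_coef alpha beta a k *
                    Gamma_coef (1 - alpha) beta abar (N - k)%N = (N == 0%N)%:R.

Definition frac_integral (R : realType) (a alpha : R) (beta : R[i])
    (A : R[i] -> R[i]) (x : R -> R) (t : R) : R[i] :=
  cintegral `[a, t] (fun s =>
    ((t - s) `^ (alpha - 1))%:C * A (cpow (t - s) beta) * (x s)%:C).

(* The kernel argument is Abar, not A. *)
Definition caputo (R : realType) (n : nat) (a alpha : R) (beta : R[i])
    (Abar : R[i] -> R[i]) (x : R -> 'rV[R]_n) (t : R) : 'rV[R[i]]_n :=
  \row_i frac_integral a (1 - alpha) beta Abar (fun s => derive1 x s ord0 i) t.

(* Finitely many discontinuities, all with finite one-sided limits; the values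
   at the discontinuities and at the endpoints are unconstrained. *)
Definition piecewise_continuous (R : realType) (V : normedModType R) (a b : R)
    (g : R -> V) : Prop :=
  [/\ exists s : seq R,
        forall t, t \in `]a, b[ -> t \notin s -> {for t, continuous g},
      forall t, t \in `[a, b[ -> cvg (g y @[y --> t^'+]) &
      forall t, t \in `]a, b] -> cvg (g y @[y --> t^'-])].

(* Such functions are continuous; only their derivative may jump. *)
Definition piecewise_C1 (R : realType) (V : normedModType R) (a b : R)
    (x : R -> V) : Prop :=
  [/\ {within `[a, b], continuous x},
      exists s : seq R,
        forall t, t \in `]a, b[ -> t \notin s -> derivable x t 1 &
      piecewise_continuous a b (derive1 x)].

(* Frechet differentiability relative to D, which need not be open.  In finite
   dimension pointwise continuity of dF is continuity in operator norm. *)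
Definition C1_on (R : realType) (V W : normedModType R) (D : set V)
    (F : V -> W) : Prop :=
  exists dF : V -> {linear V -> W},
    (forall p, D p -> forall e : R, 0 < e ->
       \forall q \near within D (nbhs p),
         `|F q - F p - dF p (q - p)| <= e * `|q - p|) /\
    (forall v : V, {within D, continuous (fun p => dF p v)}).

Definition trajectory (R : realType) (n m : nat) (a b alpha : R)
    (beta : R[i]) (Abar : R[i] -> R[i])
    (f : R -> 'rV[R]_n -> 'rV[R]_m -> 'rV[R]_n) (xa : 'rV[R]_n)
    (u : R -> 'rV[R]_m) (x : R -> 'rV[R]_n) : Prop :=
  [/\ piecewise_C1 a b x,
      forall t, t \in `[a, b] ->
        caputo a alpha beta Abar x t =
        map_mx (real_complex R) (f t (x t) (u t)) &
      x a = xa].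

(* Main.v *)
(* Convolving the Caputo equation with the kernel of A inverts it: since
   A_Gamma * Abar_Gamma = 1 and B(z, w) Gamma(z + w) = Gamma(z) Gamma(w), the
   kernels t^(alpha-1) A(t^beta) and t^(-alpha) Abar(t^beta) have convolution 1,
   because every triangular partial sum of their Cauchy product integrates to 1
   and these sums converge uniformly relative to the two singular factors.
   Isolating the coefficients requires Gamma <> 0 on the right half-plane: by
   the functional equation Re z may be taken large, and then the Gamma
   distribution is too concentrated for t^(i Im z) to average to 0.
   Hence x(t) - x_a is the weakly singular Volterra integral of f(., x, u), and
   a Gronwall estimate in the norm sup |y(t)| exp(- lambda (t - a)), with lambda
   large, bounds x^eps - x* by a constant times |eps|. *)
Require Import Defs.
From mathcomp Require Import ring lra zify measurable_realfun.
Import Order.TTheory GRing.Theory Num.Theory.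
Import numFieldNormedType.Exports.
Import ComplexField.Normc.
Local Open Scope classical_set_scope.
Local Open Scope ring_scope.
Local Open Scope complex_scope.

Set Implicit Arguments.
Unset Strict Implicit.
Unset Printing Implicit Defensive.


(** Kernels are cut off outside ]0, b - a] and powers are extended by 0 to t <= 0, so that all
    integrals run over the whole line and Fubini, translation and reflection apply without boundary
    terms. The cut-off also keeps (t - s)^beta in the closed disc of radius (b - a)^(Re beta),
    strictly inside the domain of both series. As A_Gamma may have radius of convergence 0, it is
    never summed. Only its coefficients enter: the terms of degree j in the Cauchy product of the
    two kernels all integrate to multiples of the same power, with exponent beta j, and their sum is
    the j-th coefficient of A_Gamma times Abar_Gamma, up to a common factor. In the inversion, f(.,
    x, u) appears as the inner integral of a function integrable on the plane, and this yields its
    integrability against the kernel of A. Real and imaginary parts are estimated separately, which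
    costs a factor 2 in every bound of a complex integral. *)

(** * Affine changes of variables for Lebesgue measure *)

Section change_of_variables.
Context {R : realType}.
Notation mu := (@lebesgue_measure R).

Let affine (s c : R) : measurableTypeR R -> measurableTypeR R :=
  fun x => s + c * x.

Let measurable_affine (s c : R) : measurable_fun setT (affine s c).
Proof. by apply: measurable_funD => //; apply: measurable_funM. Qed.

(** Once this measure is identified with Lebesgue measure, an affine change of variables is an
    instance of the pushforward formula. *)
Let affine_measure (s c : R) (c0 : 0 <= c) :
    {measure set (measurableTypeR R) -> \bar R} :=
  mscale (NngNum c0)
    (measure_function_pushforward__canonical__measure_function_Measure
       mu (measurable_affine s c)).

Let affine_measureE (s c : R) (c0 : 0 < c) (A : set R) : measurable A ->
  affine_measure s (ltW c0) A = mu A.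
Proof.
move=> mA; apply/esym/lebesgue_measure_unique => // _ [[a b]] _ <-.
rewrite /affine_measure /mscale/= /pushforward.
rewrite [X in _ = (_ * lebesgue_measure X)%E](_ : _ =
   `](a - s) / c, (b - s) / c]%classic); last first.
  apply/seteqP; split => x /=; rewrite /affine !in_itv/= ltr_pdivrMr// ler_pdivlMr// ltrBlDl lerBrDl mulrC;
    by move=> ->.
rewrite !lebesgue_measure_itv/= !lte_fin ltr_pM2r ?invr_gt0// ltrD2r.
case: ifPn; rewrite ?mule0// => ab.
by rewrite -!EFinB -EFinM; congr EFin; field; rewrite gt_eqF.
Qed.

Local Open Scope ereal_scope.

Lemma ge0_integral_affine (s c : R) (f : R -> \bar R) : (0 < c)%R ->
  measurable_fun [set: R] f -> (forall x, 0 <= f x) ->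
  c%:E * \int[mu]_x f (s + c * x)%R = \int[mu]_x f x.
Proof.
move=> c0 mf f0.
transitivity (\int[affine_measure s (ltW c0)]_x f x).
  rewrite ge0_integral_mscale//=.
  by rewrite ge0_integral_pushforward.
by apply: eq_measure_integral => A mA _; exact: affine_measureE.
Qed.

Lemma integrable_affine (s c : R) (f : R -> R) : (0 < c)%R ->
  mu.-integrable setT (EFin \o f) ->
  mu.-integrable setT (EFin \o (fun x => f (s + c * x)%R)).
Proof.
move=> c0 /integrableP[mf fi]; apply/integrableP; split.
  apply/measurable_EFinP; apply: (measurableT_comp (f := f)); first exact/measurable_EFinP.
  exact: measurable_affine.
have := @ge0_integral_affine s c (abse \o (EFin \o f)) c0.
move=> /(_ (measurableT_comp (@abse_measurable _ _) mf) (fun=> abse_ge0 _)).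
rewrite /= => h; move: fi; rewrite /= -h => hh.
rewrite -[ltLHS]mul1e -(mulVf (lt0r_neq0 c0)) EFinM -muleA.
by rewrite lte_mul_pinfty// lee_fin invr_ge0 ltW.
Qed.

Lemma Rintegral_affine (s c : R) (f : R -> R) : (0 < c)%R ->
  mu.-integrable setT (EFin \o f) ->
  (c * \int[mu]_x f (s + c * x) = \int[mu]_x f x)%R.
Proof.
move=> c0 fi; have fi' := integrable_affine s c0 fi.
rewrite /Rintegral.
transitivity (fine (\int[affine_measure s (ltW c0)]_x (f x)%:E)); last first.
  congr fine; apply: eq_measure_integral => A mA _; exact: affine_measureE.
have mf : measurable_fun [set: R] (EFin \o f) by case/integrableP : fi.
rewrite [in RHS]integralE [X in _ = fine (X - _)]ge0_integral_mscale//=; last first.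
  exact: measurable_funepos.
rewrite [X in _ = fine (_ - X)]ge0_integral_mscale//=; last first.
  exact: measurable_funeneg.
rewrite -muleBr//=; last first.
  by apply: integrable_add_def => //; exact: integrable_pushforward.
rewrite -integralE integral_pushforward//= fineM//.
exact: integrable_fin_num fi'.
Qed.

Let mopp : measurable_fun setT (-%R : measurableTypeR R -> measurableTypeR R).
Proof. exact: oppr_measurable. Qed.

Let opp_measure : {measure set (measurableTypeR R) -> \bar R} :=
  measure_function_pushforward__canonical__measure_function_Measure mu mopp.

Lemma ge0_integral_opp (f : R -> \bar R) :
  measurable_fun [set: R] f -> (forall x, 0 <= f x) ->
  \int[mu]_x f (- x)%R = \int[mu]_x f x.
Proof.
move=> mf f0.
transitivity (\int[opp_measure]_x f x).
  by rewrite /opp_measure/= ge0_integral_pushforward.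
by apply: eq_measure_integral => A mA _; rewrite /opp_measure/= lebesgue_measureN.
Qed.

Lemma integrable_opp (f : R -> R) :
  mu.-integrable setT (EFin \o f) ->
  mu.-integrable setT (EFin \o (fun x => f (- x)%R)).
Proof.
move=> /integrableP[mf fi]; apply/integrableP; split.
  by apply/measurable_EFinP; apply: (measurableT_comp (f := f)); first exact/measurable_EFinP.
have := @ge0_integral_opp (abse \o (EFin \o f)).
move=> /(_ (measurableT_comp (@abse_measurable _ _) mf) (fun=> abse_ge0 _)).
by move: fi; rewrite /= => h ->.
Qed.

Lemma Rintegral_opp (f : R -> R) :
  mu.-integrable setT (EFin \o f) ->
  (\int[mu]_x f (- x) = \int[mu]_x f x)%R.
Proof.
move=> fi; have fi' := integrable_opp fi.
have mf : measurable_fun [set: R] (EFin \o f) by case/integrableP : fi.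
rewrite /Rintegral; congr fine.
transitivity (\int[opp_measure]_x (f x)%:E).
  by rewrite /opp_measure/= integral_pushforward.
by apply: eq_measure_integral => A mA _; rewrite /opp_measure/= lebesgue_measureN.
Qed.

Lemma integrable_reflect (t : R) (f : R -> R) :
  mu.-integrable setT (EFin \o f) ->
  mu.-integrable setT (EFin \o (fun x => f (t - x)%R)).
Proof.
move=> /(integrable_affine t ltr01)/integrable_opp.
by apply: eq_integrable => // x _ /=; rewrite mul1r.
Qed.

Lemma Rintegral_reflect (t : R) (f : R -> R) :
  mu.-integrable setT (EFin \o f) ->
  (\int[mu]_x f (t - x) = \int[mu]_x f x)%R.
Proof.
move=> fi; rewrite -[RHS](Rintegral_affine t ltr01 fi) mul1r.
rewrite -(Rintegral_opp (integrable_affine t ltr01 fi)).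
by apply: eq_Rintegral => x _; rewrite mul1r.
Qed.

End change_of_variables.

(** * Fubini for real-valued integrals *)

Section fubini.
Context {R : realType}.
Notation mu := (@lebesgue_measure R).

(** A real integral is the [fine] part of the extended one, so the inner integrals can differ from
    the extended ones where a section is not integrable. Those sections form a null set. *)
Lemma Rintegral_Fubini (h : R * R -> R) :
  (mu \x mu)%E.-integrable setT (EFin \o h) ->
  \int[mu]_x (\int[mu]_y h (x, y)) = \int[mu]_y (\int[mu]_x h (x, y)).
Proof.
move=> hi; have := Fubini hi; rewrite /Rintegral /= => F.
have e1 : (\int[mu]_x (fine (\int[mu]_y (h (x, y))%:E))%:E =
   \int[mu]_x \int[mu]_y (h (x, y))%:E)%E.
  apply: ae_eq_integral => //.
  - apply/measurable_EFinP; apply: measurableT_comp => //.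
    exact: (measurable_fubini_F hi).
  - exact: (measurable_fubini_F hi).
  - have := integrable_fubini_F hi => /(integrable_ae measurableT).
    by apply: filterS => x /(_ I) fx _; rewrite fineK.
have e2 : (\int[mu]_y (fine (\int[mu]_x (h (x, y))%:E))%:E =
   \int[mu]_y \int[mu]_x (h (x, y))%:E)%E.
  apply: ae_eq_integral => //.
  - apply/measurable_EFinP; apply: measurableT_comp => //.
    exact: (measurable_fubini_G hi).
  - exact: (measurable_fubini_G hi).
  - have := ae_integrable2 hi.
    by apply: filterS => x fx _; rewrite fineK//; exact: integrable_fin_num.
by rewrite e1 e2 F.
Qed.

End fubini.

(** * The modulus as a real number *)

Section complex_modulus.
Context {R : realType}.
Implicit Types (z w : R[i]) (x : R).

Lemma cReM z w : complex.Re (z * w) =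
  complex.Re z * complex.Re w - complex.Im z * complex.Im w.
Proof. by case: z w => [a b] [c d]. Qed.

Lemma cImM z w : complex.Im (z * w) =
  complex.Re z * complex.Im w + complex.Im z * complex.Re w.
Proof. by case: z w => [a b] [c d]. Qed.

Lemma cReD z w : complex.Re (z + w) = complex.Re z + complex.Re w.
Proof. by case: z w => [a b] [c d]. Qed.

Lemma cImD z w : complex.Im (z + w) = complex.Im z + complex.Im w.
Proof. by case: z w => [a b] [c d]. Qed.

Lemma normc_sqrt z : normc z = Num.sqrt (complex.Re z ^+ 2 + complex.Im z ^+ 2).
Proof. by case: z. Qed.

Lemma normc_ge0 z : 0 <= normc z.
Proof. by rewrite normc_sqrt sqrtr_ge0. Qed.

Lemma norm_normc z : `|z| = (normc z)%:C.
Proof. by rewrite normc_def normc_sqrt. Qed.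

Lemma normc_real x : normc x%:C = `|x|.
Proof. by rewrite normc_sqrt/= expr0n/= addr0 sqrtr_sqr. Qed.

Lemma le_norm_Re z : `|complex.Re z| <= normc z.
Proof. by rewrite normc_sqrt -sqrtr_sqr ler_wsqrtr// lerDl sqr_ge0. Qed.

Lemma le_norm_Im z : `|complex.Im z| <= normc z.
Proof. by rewrite normc_sqrt -sqrtr_sqr ler_wsqrtr// lerDr sqr_ge0. Qed.

Lemma normc_le z : normc z <= `|complex.Re z| + `|complex.Im z|.
Proof.
rewrite normc_sqrt -[leRHS]ger0_norm ?addr_ge0// -sqrtr_sqr ler_wsqrtr//.
rewrite sqrrD !real_normK ?num_real// -addrA lerD2l addrC lerDl.
by rewrite mulrn_wge0// mulr_ge0.
Qed.

Lemma normcB z w : normc (z - w) = normc (w - z).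
Proof. by rewrite -normcN opprB. Qed.

Lemma normcX z n : normc (z ^+ n) = normc z ^+ n.
Proof. by elim: n => [|n IH]; rewrite ?normc1// !exprS normcM IH. Qed.

Lemma normc_sum (I : Type) (s : seq I) (P : pred I) (F : I -> R[i]) :
  normc (\sum_(i <- s | P i) F i) <= \sum_(i <- s | P i) normc (F i).
Proof.
elim/big_ind2 : _ => [|z x w y zx wy|//]; first by rewrite normc0.
by rewrite (le_trans (le_normcD _ _))// lerD.
Qed.

End complex_modulus.

(** * Measurability of complex-valued functions *)

Section cmeasurable.
Context d (T : measurableType d) {R : realType}.
Implicit Types g h : T -> R[i].

(** Stated on coordinates, like [cintegral], so that no sigma-algebra on [R[i]] has to be chosen. *)
Definition cmeasurable g :=
  measurable_fun setT (fun x => complex.Re (g x)) /\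
  measurable_fun setT (fun x => complex.Im (g x)).

Lemma cmeasurable_cst (c : R[i]) : cmeasurable (fun=> c).
Proof. by split; exact: measurable_cst. Qed.

Lemma cmeasurable_real (f : T -> R) :
  measurable_fun setT f -> cmeasurable (fun x => (f x)%:C).
Proof. by split => //=; exact: measurable_cst. Qed.

Lemma cmeasurableM g h : cmeasurable g -> cmeasurable h ->
  cmeasurable (fun x => g x * h x).
Proof.
move=> [g1 g2] [h1 h2]; split.
- under eq_fun do rewrite cReM.
  by apply: measurable_funB; exact: measurable_funM.
- under eq_fun do rewrite cImM.
  by apply: measurable_funD; exact: measurable_funM.
Qed.

Lemma cmeasurableD g h : cmeasurable g -> cmeasurable h ->
  cmeasurable (fun x => g x + h x).
Proof.
move=> [g1 g2] [h1 h2]; split.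
- by under eq_fun do rewrite cReD; exact: measurable_funD.
- by under eq_fun do rewrite cImD; exact: measurable_funD.
Qed.

Lemma cmeasurableX g n : cmeasurable g -> cmeasurable (fun x => g x ^+ n).
Proof.
move=> mg; elim: n => [|n IH]; first exact: cmeasurable_cst.
by under eq_fun do rewrite exprS; exact: cmeasurableM.
Qed.

Lemma cmeasurable_sum (I : Type) (s : seq I) (F : I -> T -> R[i]) :
  (forall i, cmeasurable (F i)) -> cmeasurable (fun x => \sum_(i <- s) F i x).
Proof.
move=> mF; elim: s => [|i s IH].
  by under eq_fun do rewrite big_nil; exact: cmeasurable_cst.
by under eq_fun do rewrite big_cons; exact: cmeasurableD.
Qed.

Lemma cmeasurable_if (b : T -> bool) g h : measurable_fun setT b ->
  cmeasurable g -> cmeasurable h -> cmeasurable (fun x => if b x then g x else h x).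
Proof.
move=> mb [g1 g2] [h1 h2]; split.
- by under eq_fun do rewrite (fun_if (@complex.Re R)); exact: measurable_fun_ifT.
- by under eq_fun do rewrite (fun_if (@complex.Im R)); exact: measurable_fun_ifT.
Qed.

Lemma measurable_normc g : cmeasurable g -> measurable_fun setT (fun x => normc (g x)).
Proof.
move=> [g1 g2]; rewrite (_ : (fun _ => _) = (fun x => Num.sqrt
    (complex.Re (g x) ^+ 2 + complex.Im (g x) ^+ 2))); last first.
  by apply/funext => x; rewrite normc_sqrt.
apply: (measurableT_comp (f := @Num.sqrt R)).
  by apply: continuous_measurable_fun; exact: sqrt_continuous.
by apply: measurable_funD; exact: measurable_funX.
Qed.

End cmeasurable.

Lemma cmeasurable_comp d d' (T : measurableType d) (U : measurableType d')
    {R : realType} (g : U -> R[i]) (phi : T -> U) :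
  cmeasurable g -> measurable_fun setT phi -> cmeasurable (g \o phi).
Proof. by move=> [g1 g2] mphi; split; [exact: (measurableT_comp g1)|exact: (measurableT_comp g2)]. Qed.

(** * Complex-valued integrals and convolutions *)

Section cintegral.
Context {R : realType}.
Notation mu := (@lebesgue_measure R).
Implicit Types (g h : R -> R[i]) (G : R -> R).

Definition cintegrable d (T : measurableType d)
    (nu : set T -> \bar R) (g : T -> R[i]) :=
  nu.-integrable setT (fun x => (complex.Re (g x))%:E) /\
  nu.-integrable setT (fun x => (complex.Im (g x))%:E).

Lemma cintegrable_cmeasurable g : cintegrable mu g -> cmeasurable g.
Proof.
by move=> [/integrableP[g1 _] /integrableP[g2 _]]; split; exact/measurable_EFinP.
Qed.

Lemma cintegrable_le d (T : measurableType d) (nu : {measure set T -> \bar R})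
    (g : T -> R[i]) (G : T -> R) : cmeasurable g ->
  nu.-integrable setT (EFin \o G) -> (forall x, normc (g x) <= G x) ->
  cintegrable nu g.
Proof.
move=> [g1 g2] iG gG; split; apply: (le_integrable measurableT _ _ iG).
- exact/measurable_EFinP.
- by move=> x _ /=; rewrite lee_fin (le_trans (le_norm_Re _))// (le_trans (gG x))// ler_norm.
- exact/measurable_EFinP.
- by move=> x _ /=; rewrite lee_fin (le_trans (le_norm_Im _))// (le_trans (gG x))// ler_norm.
Qed.

Lemma integrable_normc g : cintegrable mu g ->
  mu.-integrable setT (EFin \o (fun x => normc (g x))).
Proof.
move=> gi; have mg := cintegrable_cmeasurable gi.
have i12 : mu.-integrable setT
    (EFin \o (fun x => `|complex.Re (g x)| + `|complex.Im (g x)|)).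
  case: gi => g1 g2.
  exact: (integrableD measurableT (integrable_norm g1) (integrable_norm g2)).
apply: (le_integrable measurableT _ _ i12).
- exact/measurable_EFinP/measurable_normc.
- move=> x _ /=; rewrite lee_fin ger0_norm ?normc_ge0// ger0_norm ?addr_ge0//.
  exact: normc_le.
Qed.

Lemma cintegrableZl (c : R[i]) g :
  cintegrable mu g -> cintegrable mu (fun x => c * g x).
Proof.
move=> gi; apply: (@cintegrable_le _ _ mu _ (fun x => normc c * normc (g x))).
- by apply: cmeasurableM (cintegrable_cmeasurable gi); exact: cmeasurable_cst.
- have := integrableZl measurableT (normc c) (integrable_normc gi).
  by apply: eq_integrable.
- by move=> x; rewrite normcM.
Qed.

Lemma cintegrableD g h : cintegrable mu g -> cintegrable mu h ->
  cintegrable mu (fun x => g x + h x).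
Proof.
move=> [g1 g2] [h1 h2]; split.
- by under eq_fun do rewrite cReD EFinD; exact: integrableD.
- by under eq_fun do rewrite cImD EFinD; exact: integrableD.
Qed.

Lemma cintegrable0 : cintegrable mu (fun=> 0).
Proof. by split; exact: integrable0. Qed.

Lemma cintegrable_sum (I : Type) (s : seq I) (F : I -> R -> R[i]) :
  (forall i, cintegrable mu (F i)) ->
  cintegrable mu (fun x => \sum_(i <- s) F i x).
Proof.
move=> iF; elim: s => [|i s IH].
  by under eq_fun do rewrite big_nil; exact: cintegrable0.
by under eq_fun do rewrite big_cons; exact: cintegrableD.
Qed.

Lemma eq_cintegral (D : set R) g h : (forall x, D x -> g x = h x) ->
  cintegral D g = cintegral D h.
Proof.
by move=> gh; congr Complex; apply: eq_Rintegral => x; rewrite inE => /gh ->.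
Qed.

Lemma cintegral_mkcond (D : set R) g :
  cintegral D g = cintegral setT (fun x => if x \in D then g x else 0).
Proof.
rewrite /cintegral; congr Complex; rewrite Rintegral_mkcond; apply: eq_Rintegral => x _;
  by rewrite patchE; case: ifP.
Qed.

Lemma cintegralZl (c : R[i]) g : cintegrable mu g ->
  cintegral setT (fun x => c * g x) = c * cintegral setT g.
Proof.
move=> [g1 g2]; apply/eqP; rewrite eq_complex cReM cImM /=; apply/andP; split; apply/eqP.
- under eq_Rintegral do rewrite cReM.
  rewrite RintegralB//; last 2 first.
  + exact: (integrableZl measurableT (complex.Re c) g1).
  + exact: (integrableZl measurableT (complex.Im c) g2).
  by rewrite !RintegralZl.
- under eq_Rintegral do rewrite cImM.
  rewrite RintegralD//; last 2 first.
  + exact: (integrableZl measurableT (complex.Re c) g2).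
  + exact: (integrableZl measurableT (complex.Im c) g1).
  by rewrite !RintegralZl.
Qed.

Lemma cintegralD g h : cintegrable mu g -> cintegrable mu h ->
  cintegral setT (fun x => g x + h x) = cintegral setT g + cintegral setT h.
Proof.
move=> [g1 g2] [h1 h2]; apply/eqP; rewrite eq_complex cReD cImD /=.
apply/andP; split; apply/eqP.
- by under eq_Rintegral do rewrite cReD; exact: RintegralD.
- by under eq_Rintegral do rewrite cImD; exact: RintegralD.
Qed.

Lemma cintegral0 : cintegral setT (fun=> 0 : R[i]) = 0 :> R[i].
Proof. by rewrite /cintegral /= /Rintegral integral0_eq. Qed.

Lemma cintegralB g h : cintegrable mu g -> cintegrable mu h ->
  cintegral setT (fun x => g x - h x) = cintegral setT g - cintegral setT h.
Proof.
move=> gi hi; rewrite -[- cintegral _ h]mulN1r -cintegralZl// -cintegralD//.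
  by apply: eq_cintegral => x _; rewrite mulN1r.
exact: cintegrableZl.
Qed.

Lemma cintegral_sum (I : Type) (s : seq I) (F : I -> R -> R[i]) :
  (forall i, cintegrable mu (F i)) ->
  cintegral setT (fun x => \sum_(i <- s) F i x) =
  \sum_(i <- s) cintegral setT (F i).
Proof.
move=> iF; elim: s => [|i s IH].
  rewrite big_nil -[RHS]cintegral0; by apply: eq_cintegral => x _; rewrite big_nil.
rewrite big_cons -IH -cintegralD//; last exact: cintegrable_sum.
by apply: eq_cintegral => x _; rewrite big_cons.
Qed.

Lemma cintegral_real (D : set R) G :
  cintegral D (fun x => (G x)%:C) = (\int[mu]_(x in D) G x)%:C.
Proof. by rewrite /cintegral /= {2}/Rintegral integral0_eq. Qed.

(** The factor 2 comes from bounding the two coordinates separately. It is harmless, since only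
    smallness and finiteness of constants matter later. *)
Lemma normc_cintegral_le g G : cintegrable mu g ->
  mu.-integrable setT (EFin \o G) -> (forall x, normc (g x) <= G x) ->
  normc (cintegral setT g) <= 2 * \int[mu]_x G x.
Proof.
move=> [g1 g2] iG gG; rewrite (le_trans (normc_le _))//= mulr_natl mulr2n lerD//.
- rewrite (le_trans (le_normr_Rintegral _ _))// le_Rintegral//.
    exact: integrable_norm.
  by move=> x _; rewrite (le_trans (le_norm_Re _)).
- rewrite (le_trans (le_normr_Rintegral _ _))// le_Rintegral//.
    exact: integrable_norm.
  by move=> x _; rewrite (le_trans (le_norm_Im _)).
Qed.

Lemma cintegrable_affine (s c : R) g : 0 < c -> cintegrable mu g ->
  cintegrable mu (fun x => g (s + c * x)).
Proof. by move=> c0 [g1 g2]; split; [exact: (integrable_affine s c0 g1)|exact: (integrable_affine s c0 g2)]. Qed.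

Lemma cintegral_affine (s c : R) g : 0 < c -> cintegrable mu g ->
  c%:C * cintegral setT (fun x => g (s + c * x)) = cintegral setT g.
Proof.
move=> c0 [g1 g2]; apply/eqP; rewrite eq_complex cReM cImM /= !mul0r subr0 addr0.
by rewrite (Rintegral_affine s c0 g1) (Rintegral_affine s c0 g2) !eqxx.
Qed.

Lemma cintegrable_reflect (t : R) g : cintegrable mu g ->
  cintegrable mu (fun x => g (t - x)).
Proof.
by move=> [g1 g2]; split; [exact: (integrable_reflect t g1)|exact: (integrable_reflect t g2)].
Qed.

Lemma cintegral_reflect (t : R) g : cintegrable mu g ->
  cintegral setT (fun x => g (t - x)) = cintegral setT g.
Proof.
move=> [g1 g2]; rewrite /cintegral; congr Complex.
- exact: (Rintegral_reflect t g1).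
- exact: (Rintegral_reflect t g2).
Qed.

Lemma cintegral_Fubini (h : R * R -> R[i]) : cintegrable (mu \x mu)%E h ->
  cintegral setT (fun x => cintegral setT (fun y => h (x, y))) =
  cintegral setT (fun y => cintegral setT (fun x => h (x, y))).
Proof.
move=> [h1 h2]; rewrite /cintegral; congr Complex => /=.
- exact: (Rintegral_Fubini h1).
- exact: (Rintegral_Fubini h2).
Qed.

(** By Tonelli and translation invariance, the integral of the absolute value is the product of the
    two L1 norms. *)
Lemma integrable_convolution (P Q : R -> R) :
  mu.-integrable setT (EFin \o P) -> mu.-integrable setT (EFin \o Q) ->
  (mu \x mu)%E.-integrable setT (fun z => (P z.1 * Q (z.2 - z.1))%:E).
Proof.
move=> iP iQ.
have mP : measurable_fun setT P by apply/measurable_EFinP; case/integrableP : iP.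
have mQ : measurable_fun setT Q by apply/measurable_EFinP; case/integrableP : iQ.
apply/integrable12ltyP.
  apply/measurable_EFinP; apply: measurable_funM.
    exact: measurableT_comp.
  apply: (measurableT_comp mQ); exact: measurable_funB.
rewrite [ltLHS](_ : _ = \int[mu]_x ((\int[mu]_y `|Q y|%:E) * `|P x|%:E))%E; last first.
  apply: eq_integral.
  move=> x _ /=; under eq_integral do rewrite normrM EFinM.
  rewrite ge0_integralZl//; last first.
    apply/measurable_EFinP; apply: measurableT_comp => //.
    by apply: (measurableT_comp mQ); exact: measurable_funB.
  rewrite muleC; congr (_ * _)%E.
  have := @ge0_integral_affine R (- x) 1 (fun y => `|Q y|%:E) ltr01.
  rewrite mul1e => <-//.
  - by apply: eq_integral => y _; rewrite mul1r addrC.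
  - by apply/measurable_EFinP; exact: measurableT_comp.
have /integrableP[_ Pf] := iP; have /integrableP[_ Qf] := iQ.
rewrite ge0_integralZl//.
- by apply: lte_mul_pinfty => //; [exact: integral_ge0|rewrite ge0_fin_numE//; exact: integral_ge0].
- by apply/measurable_EFinP; exact: measurableT_comp.
- exact: integral_ge0.
Qed.

End cintegral.

(** * Fundamental theorem of calculus with finitely many exceptional points *)

Section ftc.
Context {R : realType}.
Notation mu := (@lebesgue_measure R).

(** Induction on the list of exceptional points: an interior one splits the interval, and continuity
    of [F] makes the two increments add up. *)
Lemma FTC_finite_exceptions (s : seq R) (f F : R -> R) (a b : R) : a <= b ->
  mu.-integrable `[a, b] (EFin \o f) -> {within `[a, b], continuous F} ->
  (forall x, x \in `]a, b[ -> x \notin s ->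
     {for x, continuous f} /\ is_derive x 1 F (f x)) ->
  \int[mu]_(x in `[a, b]) f x = F b - F a.
Proof.
rewrite le_eqVlt => /predU1P[<- _ _ _|].
  by rewrite set_itv1 Rintegral_set1 subrr.
elim: s a b => [|p s IH] a b ab fi Fc dF.
  (* Without exceptional points, [F - G] is continuous with zero derivative inside, hence has equal
     values at [a] and [b]. *)
  pose G x := \int[mu]_(t in `[a, x]) f t.
  have Gc : {within `[a, b], continuous G}.
    exact: (parameterized_integral_continuous (ltW ab) fi).
  have dH x : x \in `]a, b[ -> is_derive x 1 (F - G) 0.
    move=> xab; have [//|cf dFx] := dF _ xab.
    have [dG G'] : derivable G x 1 /\ derive1 G x = f x.
      move: xab; rewrite in_itv/= => /andP[ax xb].
      exact: (continuous_FTC1_closed xb fi).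
    rewrite -(subrr (f x)).
    apply: is_deriveB; split => //.
    by rewrite -derive1E.
  have cH : {within `[a, b], continuous (F - G)}.
    by move=> x; exact: continuousB (Fc x) (Gc x).
  have [c _] := MVT ab dH cH.
  rewrite mul0r => e.
  have {e} : F b - G b - (F a - G a) = 0 by exact: e.
  rewrite [G a](_ : _ = 0); last by rewrite /G set_itv1 Rintegral_set1.
  by move=> e; rewrite -/(G b); lra.
have sub (c d x : R) : a <= c -> d <= b -> x \in `]c, d[ -> x \in `]a, b[.
  move=> ac db; rewrite !in_itv/= => /andP[cx xd].
  by rewrite (le_lt_trans ac)// (lt_le_trans xd).
have [pab|pab] := boolP (p \in `]a, b[); last first.
  apply: IH => // x xab xs; apply: dF => //; rewrite inE negb_or xs andbT.
  by apply: contraNneq pab => <-.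
move: (pab); rewrite in_itv/= => /andP[ap pb].
rewrite -(subrK (F p) (F b)) -addrA addrC -(IH a p)//.
- rewrite -(IH p b)//.
  + have fpb : mu.-integrable `]p, b] (EFin \o f).
      by apply: integrableS fi => //; apply: subset_itvr; rewrite bnd_simp ltW.
    rewrite -[X in _ = _ + X]Rintegral_itv_obnd_cbnd//.
    rewrite -(Rintegral_itvB fi) ?bnd_simp ?ltW//.
    by rewrite addrC subrK.
  + by apply: integrableS fi => //; apply: subset_itvr; rewrite bnd_simp ltW.
  + by apply: continuous_subspaceW Fc; apply: subset_itvr; rewrite bnd_simp ltW.
  + move=> x xpb xs; apply: dF; first exact: (sub p b x (ltW ap) (lexx b)).
    rewrite inE negb_or xs andbT; move: xpb; rewrite in_itv/= => /andP[px _].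
    by rewrite gt_eqF.
- by apply: integrableS fi => //; apply: subset_itvl; rewrite bnd_simp ltW.
- by apply: continuous_subspaceW Fc; apply: subset_itvl; rewrite bnd_simp ltW.
- move=> x xpb xs; apply: dF; first exact: (sub a p x (lexx a) (ltW pb)).
  rewrite inE negb_or xs andbT; move: xpb; rewrite in_itv/= => /andP[_ px].
  by rewrite lt_eqF.
Qed.

End ftc.

(** * Complex powers and their integrability *)

Section powers.
Context {R : realType}.
Notation mu := (@lebesgue_measure R).
Implicit Types (x t s : R) (z w : R[i]).

Lemma cpowM s t z : 0 < s -> 0 < t -> cpow (s * t) z = cpow s z * cpow t z.
Proof.
move=> s0 t0; rewrite /cpow lnM ?posrE// mulrDr cosD sinD powRM ?ltW//.
apply/eqP; rewrite eq_complex !cReM !cImM/= !mul0r !subr0 !addr0; apply/andP; split; apply/eqP; ring.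
Qed.

Lemma cpowD t z w : 0 < t -> cpow t (z + w) = cpow t z * cpow t w.
Proof.
move=> t0; rewrite /cpow cReD cImD mulrDl cosD sinD powRD; last by rewrite (gt_eqF t0) implybT.
apply/eqP; rewrite eq_complex !cReM !cImM/= !mul0r !subr0 !addr0; apply/andP; split; apply/eqP; ring.
Qed.

Lemma cpow_real t x : cpow t x%:C = (t `^ x)%:C.
Proof. by rewrite /cpow/= mul0r cos0 sin0 -complexr0 mulr1. Qed.

Lemma cpow0 t : cpow t 0 = 1.
Proof. by rewrite -[0]/(0%:C) cpow_real powRr0. Qed.

Lemma cpow1 t : 0 <= t -> cpow t 1 = t%:C.
Proof. by move=> t0; rewrite -[1]/(1%:C) cpow_real powRr1. Qed.

Lemma cpow1l z : cpow 1 z = 1.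
Proof. by rewrite /cpow powR1 ln1 mulr0 cos0 sin0 mulr1. Qed.

Lemma cpowMn t z (n : nat) : 0 < t -> cpow t (z * n%:R) = cpow t z ^+ n.
Proof.
move=> t0; elim: n => [|n IH]; first by rewrite mulr0 cpow0 expr0.
by rewrite -natr1 mulrDr mulr1 cpowD// IH exprSr.
Qed.

Lemma normc_cpow t z : normc (cpow t z) = t `^ complex.Re z.
Proof.
rewrite /cpow normcM normc_real ger0_norm ?powR_ge0//.
by rewrite normc_sqrt/= cos2Dsin2 sqrtr1 mulr1.
Qed.

Lemma cmeasurable_cpow z : cmeasurable (fun t : R => cpow t z).
Proof.
apply: cmeasurableM.
  by apply: cmeasurable_real; exact: measurable_powR.
split => /=.
- apply: (measurableT_comp (f := @cos R)).
    by apply: continuous_measurable_fun; exact: continuous_cos.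
  by apply: measurable_funM => //; exact: measurable_ln.
- apply: (measurableT_comp (f := @sin R)).
    by apply: continuous_measurable_fun; exact: continuous_sin.
  by apply: measurable_funM => //; exact: measurable_ln.
Qed.

(** The truncated power t_+^(z-1). With the exponent shifted by 1, convolution adds the parameters,
    and Gamma z is the integral of [pos_pow z] against exp(-t). *)
Definition pos_pow z t : R[i] := if 0 < t then cpow t (z - 1) else 0.

Definition rpos_pow x t : R := if 0 < t then t `^ (x - 1) else 0.

Lemma rpos_pow_ge0 x t : 0 <= rpos_pow x t.
Proof. by rewrite /rpos_pow; case: ifP => // _; exact: powR_ge0. Qed.

Lemma normc_pos_pow z t : normc (pos_pow z t) = rpos_pow (complex.Re z) t.
Proof.
rewrite /pos_pow /rpos_pow; case: ifP => _; last exact: normc0.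
by rewrite normc_cpow; case: z.
Qed.

Lemma pos_pow_real x t : pos_pow x%:C t = (rpos_pow x t)%:C.
Proof.
rewrite /pos_pow /rpos_pow; case: ifP => // _.
by rewrite -cpow_real rmorphB.
Qed.

Lemma cmeasurable_pos_pow z : cmeasurable (pos_pow z).
Proof.
apply: cmeasurable_if; last exact: cmeasurable_cst.
  exact: measurable_fun_ltr.
by apply: cmeasurable_cpow.
Qed.

Lemma measurable_rpos_pow x : measurable_fun setT (rpos_pow x).
Proof.
apply: measurable_fun_ifT => //; first exact: measurable_fun_ltr.
Qed.

(** Monotone convergence along the intervals [1/(n+1), 1], on which the integral is (1 - (n+1)^(-x))
    / x, hence at most 1/x. *)
Lemma integrable_powR01 x : 0 < x ->
  mu.-integrable `]0, 1] (EFin \o (fun t => t `^ (x - 1))).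
Proof.
move=> x0; apply/integrableP; split.
  by apply/measurable_EFinP; apply: measurable_funTS; exact: measurable_powR.
under eq_integral do rewrite /= ger0_norm ?powR_ge0//.
pose A (n : nat) : set R := `[n.+1%:R^-1, 1]%classic.
have AE : `]0, 1]%classic = \bigcup_n A n.
  apply/seteqP; split => t /=; last first.
    move=> [n _]; rewrite /A/= !in_itv/= => /andP[nt ->].
    by rewrite (lt_le_trans _ nt)// invr_gt0.
  rewrite in_itv/= => /andP[t0 t1].
  exists (Num.truncn t^-1) => //; rewrite /A/= in_itv/= t1 andbT.
  by rewrite invf_ple ?posrE ?ltr0n// ltW// truncnS_gt.
rewrite AE.
have ndA : nondecreasing_seq A.
  move=> i j ij; rewrite subsetEset => t; rewrite /A/= !in_itv/= => /andP[it ->].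
  by rewrite (le_trans _ it)// lef_pV2 ?posrE// ler_nat ltnS.
have mA i : measurable (A i) by rewrite /A; exact: measurable_itv.
have mf i : measurable_fun (A i) (fun t : R => (t `^ (x - 1))%:E).
  by apply/measurable_EFinP; apply: measurable_funTS; exact: measurable_powR.
have f0 (i : nat) t : A i t -> (0 <= (t `^ (x - 1))%:E)%E by rewrite lee_fin powR_ge0.
have cv := ge0_nondecreasing_set_cvg_integral (mu := mu) ndA mA mf f0.
rewrite (_ : (\int[_]_(_ in _) _)%E = limn (fun i => \int[mu]_(t in A i) (t `^ (x - 1))%:E)%E); last first.
  by apply/esym/cvg_lim.
apply: (@le_lt_trans _ _ (x^-1)%:E); last exact: ltry.
apply: lime_le; first by apply/cvg_ex; eexists; exact: cv.
apply: nearW => n.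
have n01 : (n.+1%:R^-1 : R) <= 1 by rewrite invf_le1 ?ler1n// ltr0n.
have n0 : 0 < (n.+1%:R^-1 : R) by rewrite invr_gt0 ltr0n.
have cf t : 0 < t -> {for t, continuous (fun t : R => t `^ (x - 1))}.
  move=> t0; apply: differentiable_continuous; apply/derivable1_diffP.
  by apply: derivable_powR; rewrite in_itv/= t0.
have cF t : 0 < t -> {for t, continuous (fun t : R => x^-1 * t `^ x)}.
  move=> t0; apply: differentiable_continuous; apply/derivable1_diffP.
  by apply: derivableM => //; apply: derivable_powR; rewrite in_itv/= t0.
have fi : mu.-integrable (A n) (EFin \o (fun t => t `^ (x - 1))).
  apply: continuous_compact_integrable; first exact: segment_compact.
  apply: continuous_in_subspaceT => t; rewrite inE /A/= in_itv/= => /andP[nt _].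
  by apply: cf; exact: lt_le_trans nt.
have h : \int[mu]_(t in A n) (t `^ (x - 1)) =
    x^-1 * 1 `^ x - x^-1 * n.+1%:R^-1 `^ x.
  apply: (@FTC_finite_exceptions R [::] _ (fun t => x^-1 * t `^ x) _ _ n01 fi).
  - apply: continuous_in_subspaceT => t.
    rewrite inE/= in_itv/= => /andP[nt _].
    by apply: cF; exact: lt_le_trans nt.
  - move=> t; rewrite in_itv/= => /andP[nt _] _.
    have t0 := lt_trans n0 nt.
    split; first exact: cf.
    have := is_deriveZ x^-1 (is_derive1_powR x t0).
    by rewrite /GRing.scale/= mulrA mulVf ?mul1r// gt_eqF.
have /fineK <- : (\int[mu]_(t in A n) (t `^ (x - 1))%:E)%E \is a fin_num.
  by apply: integrable_fin_num fi; rewrite /A; exact: measurable_itv.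
rewrite lee_fin [leLHS]h powR1 mulr1 gerBl mulr_ge0 ?powR_ge0//.
by rewrite invr_ge0 ltW.
Qed.

(** This is y <= exp(y) at y = t / (2 x), raised to the power x. *)
Lemma powR_le_expR x t : 0 < x -> 0 < t ->
  t `^ x <= (2 * x) `^ x * expR (2^-1 * t).
Proof.
move=> x0 t0.
have -> : expR (2^-1 * t) = expR (t / (2 * x)) `^ x.
  by rewrite -expRM; congr expR; field; rewrite gt_eqF.
have x20 : 0 < 2 * x by rewrite mulr_gt0.
rewrite -powRM ?expR_ge0// ?(ltW x20)//.
apply: (ge0_ler_powR (ltW x0)).
- by rewrite nnegrE ltW.
- by rewrite nnegrE mulr_ge0 ?expR_ge0// ltW.
rewrite -ler_pdivrMl// mulrC; apply: le_trans (expR_ge1Dx _).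
by rewrite lerDr.
Qed.

Lemma integrable_rpos_powR_expR x : 0 < x ->
  mu.-integrable setT (EFin \o (fun t => rpos_pow x t * expR (- t))).
Proof.
move=> x0.
(* The power alone dominates on ]0, 1]. Beyond 1, half of the exponential decay absorbs the power;
   the leading 2 in [C] cancels the normalization of the density of rate 1/2. *)
pose G1 : R -> R := (fun t => t `^ (x - 1)) \_ `]0, 1].
pose G2 : R -> R := exponential_pdf 2^-1.
pose C : R := 2 * (2 * x) `^ x.
have i1 : mu.-integrable setT (EFin \o G1).
  rewrite /G1 -restrict_EFin; apply/integrable_restrict => //=.
  by rewrite setTI; exact: integrable_powR01.
have i2 : mu.-integrable setT (EFin \o (fun t => C * G2 t)).
  have h2 : (0 < 2^-1 :> R) by rewrite invr_gt0.
  have := integrable_exponential_pdf h2.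
  exact: (integrableZl measurableT C ).
have i3 : mu.-integrable setT (EFin \o (fun t => G1 t + C * G2 t)).
  exact: (integrableD measurableT i1 i2).
have G10 t : 0 <= G1 t.
  by apply: restrict_ge0 => u _; exact: powR_ge0.
have C0 : 0 <= C by rewrite mulr_ge0// powR_ge0.
have G20 t : 0 <= G2 t by apply: exponential_pdf_ge0; rewrite invr_ge0.
have CG0 t : 0 <= C * G2 t by exact: mulr_ge0.
apply: (le_integrable measurableT _ _ i3).
  apply/measurable_EFinP; apply: measurable_funM.
    exact: measurable_rpos_pow.
  by apply: (measurableT_comp (f := @expR R)); [exact: measurable_expR|exact: oppr_measurable].
move=> t _ /=; rewrite lee_fin ger0_norm ?mulr_ge0 ?expR_ge0 ?rpos_pow_ge0//.
rewrite ger0_norm ?addr_ge0//.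
rewrite /rpos_pow; case: ifPn => t0; last by rewrite mul0r addr_ge0.
have [t1|t1] := leP t 1.
  rewrite -[leLHS]addr0 lerD//.
  rewrite /G1 patchE mem_set/= ?in_itv/= ?t0//.
  by rewrite ler_piMr ?powR_ge0// -expR0 ler_expR oppr_le0 ltW.
apply: le_trans (lerD (G10 t) (lexx _)); rewrite add0r.
rewrite /G2 (exponential_pdfE _ (ltW t0)) /C.
rewrite [leRHS](_ : _ = (2 * x) `^ x * expR (- 2^-1 * t)); last by field.
rewrite (_ : expR (- t) = expR (- 2^-1 * t) * expR (- 2^-1 * t)); last first.
  by rewrite -expRD; congr expR; field.
rewrite mulrA ler_wpM2r ?expR_ge0//.
rewrite mulNr expRN ler_pdivrMr ?expR_gt0//.
apply: le_trans (powR_le_expR x0 t0).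
by apply: ler_powR; [exact: ltW|rewrite gerBl].
Qed.

End powers.

(** * Elementary inequalities *)

Section elementary_bounds.
Context {R : realType}.
Implicit Types (x u y : R).

Lemma sqr_sin_le x : sin x ^+ 2 <= x ^+ 2.
Proof.
wlog x0 : x / 0 <= x.
  move=> H; have [x0|x0] := leP 0 x; first exact: H.
  by have := H (- x); rewrite sinN !sqrrN; apply; rewrite oppr_ge0 ltW.
have [c _] := @MVT_segment R sin cos 0 x x0 (fun t _ => is_derive_sin t)
  (continuous_subspaceT (@continuous_sin R)).
rewrite sin0 !subr0 => ->; by rewrite exprMn ler_piMl ?sqr_ge0// -(cos2Dsin2 c) lerDl sqr_ge0.
Qed.

Lemma cos_ge_quadratic x : 1 - x ^+ 2 / 2 <= cos x.
Proof.
have -> : x = (x / 2) *+ 2 by rewrite -mulr_natr; field.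
rewrite cos_mulr2n.
have := cos2Dsin2 (x / 2); have := sqr_sin_le (x / 2).
rewrite -mulr_natr => h1 h2.
lra.
Qed.

(** With u = exp(2 w), the right side is 4 (exp(w) - exp(-w))^2 and the left side is 4 w^2. *)
Lemma sqr_ln_le u : 0 < u -> ln u ^+ 2 <= 4 * (u - 2 + u^-1).
Proof.
move=> u0; pose w := ln u / 2.
have uE : u = expR w ^+ 2.
  by rewrite -expRM_natr /w (_ : _ * _ = ln u) ?lnK ?posrE//; field.
have e0 : 0 < expR w := expR_gt0 w.
have -> : u - 2 + u^-1 = (expR w - expR (- w)) ^+ 2.
  by rewrite expRN uE; field; rewrite gt_eqF.
have -> : ln u ^+ 2 = 4 * w ^+ 2 by rewrite /w; field.
rewrite ler_pM2l//.
have key (v : R) : 0 <= v -> v ^+ 2 <= (expR v - expR (- v)) ^+ 2.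
  move=> v0; rewrite ler_pXn2r// ?nnegrE ?subr_ge0 ?ler_expR; last first.
    by rewrite ge0_cp.
  have := expR_ge1Dx v.
  have : expR (- v) <= 1 by rewrite -expR0 ler_expR oppr_le0.
  lra.
have [w0|w0] := leP 0 w; first exact: key.
rewrite -sqrrN -[leRHS]sqrrN opprB.
by have := key (- w); rewrite opprK; apply; rewrite oppr_ge0 ltW.
Qed.

(** The bound is linear in u and 1/u, so that integrating it against a Gamma density involves only
    Gamma values at neighbouring arguments. *)
Lemma cos_ln_ge y u : 0 < u ->
  1 - 2 * y ^+ 2 * (u - 2 + u^-1) <= cos (y * ln u).
Proof.
move=> u0; apply: le_trans (cos_ge_quadratic _).
rewrite lerD2l lerN2 exprMn.
have := ler_wpM2l (sqr_ge0 y) (sqr_ln_le u0); lra.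
Qed.

(** The bound is 1 when x >= 1 and 2^(1-x) otherwise; their sum serves both cases. *)
Lemma powR_half_le x v : 2^-1 <= v <= 1 -> v `^ (x - 1) <= 1 + 2 `^ (1 - x).
Proof.
move=> /andP[v2 v1]; have v0 : 0 < v by rewrite (lt_le_trans _ v2)// invr_gt0.
have [x1|x1] := leP 1 x.
  rewrite -[leLHS]addr0 lerD ?powR_ge0//.
  have one : 1 `^ (x - 1) = 1 :> R by rewrite powR1.
  rewrite -[leRHS]one; apply: ge0_ler_powR => //.
  - by rewrite subr_ge0.
  - by rewrite nnegrE ltW.
  - by rewrite nnegrE.
rewrite -[leLHS]add0r lerD//.
rewrite -opprB powRN -powR_inv1 ?powR_ge0// powRAC powR_inv1 ?(ltW v0)//.
apply: ge0_ler_powR.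
- by rewrite subr_ge0 ltW.
- by rewrite nnegrE invr_ge0 ltW.
- by rewrite nnegrE.
by rewrite -(invrK 2) lef_pV2 ?posrE.
Qed.

End elementary_bounds.

(** * The Gamma and Beta integrals *)

Section gamma_beta.
Context {R : realType}.
Notation mu := (@lebesgue_measure R).
Implicit Types (x t s : R) (z w : R[i]).

Definition gamma_fun z t : R[i] := pos_pow z t * (expR (- t))%:C.

Lemma normc_gamma_fun z t :
  normc (gamma_fun z t) = rpos_pow (complex.Re z) t * expR (- t).
Proof.
by rewrite /gamma_fun normcM normc_pos_pow normc_real ger0_norm ?expR_ge0.
Qed.

Lemma cintegrable_gamma_fun z : 0 < complex.Re z -> cintegrable mu (gamma_fun z).
Proof.
move=> z0; apply: (cintegrable_le _ (integrable_rpos_powR_expR z0)).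
  apply: cmeasurableM (cmeasurable_pos_pow z) _.
  apply: cmeasurable_real.
  by apply: (measurableT_comp (f := @expR R)); [exact: measurable_expR|exact: oppr_measurable].
by move=> t; rewrite normc_gamma_fun.
Qed.

Lemma Gamma_intE z : Gamma_int z = cintegral setT (gamma_fun z).
Proof.
rewrite /Gamma_int cintegral_mkcond; apply: eq_cintegral => t _.
have -> : (t \in `]0, +oo[%classic) = (0 < t).
  by apply/idP/idP; rewrite inE/= in_itv/= andbT.
by rewrite /gamma_fun /pos_pow; case: ifP => // _; rewrite mul0r.
Qed.

Lemma Gamma_int1 : Gamma_int (1 : R[i]) = 1.
Proof.
rewrite Gamma_intE.
rewrite (@eq_cintegral _ setT _ (fun t => (if 0 < t then expR (- t) else 0)%:C)); last first.
  move=> t _; rewrite /gamma_fun /pos_pow; case: ifPn => t0; last by rewrite mul0r.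
  by rewrite subrr cpow0 mul1r.
rewrite cintegral_real /Rintegral.
rewrite (_ : (\int[mu]_x _)%E = (1%:E)%E)//.
rewrite -(@integral_exponential_pdf R 1 ltr01).
apply: ae_eq_integral => //.
- apply/measurable_EFinP; apply: measurable_fun_ifT => //.
    exact: measurable_fun_ltr.
  by apply: (measurableT_comp (f := @expR R)); [exact: measurable_expR|exact: oppr_measurable].
- by apply/measurable_EFinP; exact: measurable_exponential_pdf.
(* At 0 the density is 1 whereas the truncated integrand is 0. *)
- exists [set 0]; split => //; first exact: lebesgue_measure_set1.
  move=> t /=; apply: contra_notP => t0 _; congr EFin.
  have [{}t0|{}t0|/esym//] := ltgtP 0 t.
  + by rewrite exponential_pdfE ?ltW// mul1r mulN1r.
  + by rewrite lt0_exponential_pdf.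
Qed.

Definition beta_fun z w (u : R) : R[i] := pos_pow z (1 - u) * pos_pow w u.

Definition beta_int z w : R[i] := cintegral setT (beta_fun z w).

Lemma cmeasurable_conv_pow z w t s :
  cmeasurable (fun r : R => pos_pow z (t - r) * pos_pow w (r - s)).
Proof.
apply: cmeasurableM.
- apply: (cmeasurable_comp (g := pos_pow z) (cmeasurable_pos_pow z)).
  exact: measurable_funB.
- apply: (cmeasurable_comp (g := pos_pow w) (cmeasurable_pos_pow w)).
  exact: measurable_funB.
Qed.

(** On each half of [0, 1] one factor is bounded and the other is dominated by a Gamma integrand,
    already known to be integrable. *)
Lemma cintegrable_beta_fun z w : 0 < complex.Re z -> 0 < complex.Re w ->
  cintegrable mu (beta_fun z w).
Proof.
move=> z0 w0; set x := complex.Re z; set y := complex.Re w.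
(* The factor e pays for inserting exp(-v), because 1 <= exp(1 - v) when v <= 1. *)
pose Cx := (1 + 2 `^ (1 - x)) * expR 1.
pose Cy := (1 + 2 `^ (1 - y)) * expR 1.
have Cx0 : 0 <= Cx by rewrite mulr_ge0 ?expR_ge0 ?addr_ge0 ?powR_ge0.
have Cy0 : 0 <= Cy by rewrite mulr_ge0 ?expR_ge0 ?addr_ge0 ?powR_ge0.
pose g q t := rpos_pow q t * expR (- t) : R.
have g0 q t : 0 <= g q t by rewrite mulr_ge0 ?expR_ge0 ?rpos_pow_ge0.
have i1 := integrableZl measurableT Cx (integrable_rpos_powR_expR w0).
have i2 := integrableZl measurableT Cy
  (integrable_normc (cintegrable_reflect 1 (cintegrable_gamma_fun z0))).
apply: (@cintegrable_le _ _ _ mu _ (fun u => Cx * g y u + Cy * normc (gamma_fun z (1 - u)))).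
- by have := cmeasurable_conv_pow z w 1 0; under eq_fun do rewrite subr0.
- exact: (integrableD measurableT i1 i2).
move=> u; rewrite normcM !normc_pos_pow normc_gamma_fun -/(g _ _) -/x -/y.
have C1 q v : 2^-1 <= v <= 1 -> rpos_pow q v <= 1 + 2 `^ (1 - q).
  move=> v2; rewrite /rpos_pow; case: ifP => _; first exact: powR_half_le.
  by rewrite addr_ge0 ?powR_ge0.
have C2 q v : v <= 1 -> rpos_pow q v <= expR 1 * g q v.
  move=> v1; rewrite /g mulrCA ler_peMr ?rpos_pow_ge0// -expRD.
  by rewrite -[leLHS]expR0 ler_expR subr_ge0.
have [u1|u1] := leP 1 u.
  rewrite /rpos_pow subr_gt0 ltNge u1/= mul0r addr_ge0// mulr_ge0//.
have [u0|u0] := leP u 0.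
  by rewrite [X in _ * X]/rpos_pow ltNge u0/= mulr0 addr_ge0// mulr_ge0.
have [u2|u2] := leP u (2^-1).
- rewrite -[leLHS]addr0; apply: lerD; last exact: mulr_ge0.
  rewrite /Cx -mulrA; apply: ler_pM; rewrite ?rpos_pow_ge0//.
    by apply: C1; lra.
  by apply: C2; lra.
- rewrite -[leLHS]add0r; apply: lerD; first exact: mulr_ge0.
  rewrite mulrC /Cy -mulrA; apply: ler_pM; rewrite ?rpos_pow_ge0//.
    by apply: C1; lra.
  by apply: C2; lra.
Qed.

(** The argument of [beta_fun] is (r - s) / (t - s), in the affine form that [cintegral_affine]
    takes. *)
Lemma conv_pow_scale z w t s r : s < t ->
  pos_pow z (t - r) * pos_pow w (r - s) =
  cpow (t - s) (z + w - 1 - 1) *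
    beta_fun z w (- s / (t - s) + (t - s)^-1 * r).
Proof.
move=> st; have c0 : 0 < t - s by rewrite subr_gt0.
rewrite /beta_fun.
have -> : - s / (t - s) + (t - s)^-1 * r = (r - s) / (t - s) by rewrite [_^-1 * r]mulrC -mulrDl addrC.
have -> : 1 - (r - s) / (t - s) = (t - r) / (t - s) by field; rewrite gt_eqF.
rewrite /pos_pow !pmulr_lgt0 ?invr_gt0//.
case: ifPn => tr; last by rewrite mul0r mul0r mulr0.
case: ifPn => rs; last by rewrite !mulr0.
have -> : z + w - 1 - 1 = (z - 1) + (w - 1) by ring.
rewrite [in RHS]cpowD// [in RHS]mulrACA -!cpowM ?divr_gt0//.
by rewrite ![(t - s) * _]mulrC !divfK// gt_eqF.
Qed.

Lemma conv_pow0 z w t s r : t <= s ->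
  pos_pow z (t - r) * pos_pow w (r - s) = 0.
Proof.
move=> ts; rewrite /pos_pow !subr_gt0.
case: ifPn => rt; last by rewrite mul0r.
by rewrite ltNge (le_trans (ltW rt) ts) mulr0.
Qed.

Lemma cintegrable_conv_pow z w t s : 0 < complex.Re z -> 0 < complex.Re w ->
  cintegrable mu (fun r : R => pos_pow z (t - r) * pos_pow w (r - s)).
Proof.
move=> z0 w0; have [ts|st] := leP t s.
  by under eq_fun do rewrite (conv_pow0 _ _ _ ts); exact: cintegrable0.
under eq_fun do rewrite (conv_pow_scale _ _ _ st).
apply: cintegrableZl; apply: (@cintegrable_affine R _ _ (beta_fun z w)).
  by rewrite invr_gt0 subr_gt0.
exact: cintegrable_beta_fun.
Qed.

Lemma cintegral_conv_pow z w t s : 0 < complex.Re z -> 0 < complex.Re w ->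
  cintegral setT (fun r : R => pos_pow z (t - r) * pos_pow w (r - s)) =
  pos_pow (z + w) (t - s) * beta_int z w.
Proof.
move=> z0 w0; have [ts|st] := leP t s.
  under eq_fun do rewrite (conv_pow0 _ _ _ ts).
  by rewrite cintegral0 /pos_pow subr_gt0 ltNge ts mul0r.
have c0 : 0 < t - s by rewrite subr_gt0.
have bi := cintegrable_beta_fun z0 w0.
under eq_fun do rewrite (conv_pow_scale _ _ _ st).
have ci0 : 0 < (t - s)^-1 by rewrite invr_gt0.
rewrite cintegralZl; last exact: (@cintegrable_affine R _ _ (beta_fun z w)).
rewrite /beta_int -(cintegral_affine (- s / (t - s)) ci0 bi) /pos_pow c0 mulrA.
(* The Jacobian t - s raises the exponent from z + w - 2 to z + w - 1. *)
congr (_ * _); rewrite -[in RHS](subrK 1 (z + w - 1)) [in RHS]cpowD// [cpow _ 1]cpow1 ?(ltW c0)//.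
by rewrite -mulrA -rmorphM/= mulfV ?gt_eqF// mulr1.
Qed.

(** [B] leaves room for an extra bounded factor in [H], which is the path in the Volterra
    inversion. *)
Lemma cintegrable_convolution (F G : R -> R[i]) (H : R * R -> R[i]) (B : R) :
  cintegrable mu F -> cintegrable mu G -> cmeasurable H ->
  (forall a b, normc (H (a, b)) <= B * (normc (F a) * normc (G (b - a)))) ->
  cintegrable (mu \x mu)%E H.
Proof.
move=> iF iG mH HB.
have := integrable_convolution (integrable_normc iF) (integrable_normc iG).
move=> /(integrableZl measurableT B) i.
apply: (@cintegrable_le _ _ _ (mu \x mu)%E _
  (fun p => B * (normc (F p.1) * normc (G (p.2 - p.1))))) => //.
by case=> a b; exact: HB.
Qed.

(** The convolution of two Gamma integrands is integrated over the plane in both orders. The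
    exponentials combine to exp(-y), so one order leaves a convolution of pure powers. *)
Lemma Gamma_int_beta z w : 0 < complex.Re z -> 0 < complex.Re w ->
  Gamma_int z * Gamma_int w = beta_int z w * Gamma_int (z + w).
Proof.
move=> z0 w0; have zw0 : 0 < complex.Re (z + w) by rewrite cReD addr_gt0.
pose H (p : R * R) := gamma_fun w p.1 * gamma_fun z (p.2 - p.1).
have iz := cintegrable_gamma_fun z0; have iw := cintegrable_gamma_fun w0.
have iH : cintegrable (mu \x mu)%E H.
  apply: (@cintegrable_convolution (gamma_fun w) (gamma_fun z) _ 1) => //.
  - apply: cmeasurableM.
      by apply: (cmeasurable_comp (g := gamma_fun w)) => //; exact: cintegrable_cmeasurable.
    apply: (cmeasurable_comp (g := gamma_fun z)); first exact: cintegrable_cmeasurable.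
    exact: measurable_funB.
  - by move=> a b; rewrite mul1r /H normcM.
have e1 : cintegral setT (fun x => cintegral setT (fun y => H (x, y))) =
    Gamma_int z * Gamma_int w.
  rewrite !Gamma_intE -cintegralZl//; apply: eq_cintegral => x _.
  rewrite -(cintegral_affine (- x) ltr01 iz) mul1r mulrC.
  rewrite -[in RHS]cintegralZl; last exact: (cintegrable_affine (- x) ltr01 iz).
  by apply: eq_cintegral => y _; rewrite /H/= mul1r addrC.
have e2 : cintegral setT (fun y => cintegral setT (fun x => H (x, y))) =
    beta_int z w * Gamma_int (z + w).
  rewrite [in RHS]Gamma_intE -cintegralZl; last exact: cintegrable_gamma_fun.
  apply: eq_cintegral => y _.
  rewrite (@eq_cintegral _ setT _ (fun x => (expR (- y))%:C *
    (pos_pow z (y - x) * pos_pow w (x - 0)))); last first.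
    move=> x _; rewrite /H/= /gamma_fun subr0.
    have -> : - y = - x + - (y - x) by ring.
    by rewrite expRD rmorphM/= mulrACA mulrC [pos_pow w x * _]mulrC.
  rewrite cintegralZl; last exact: cintegrable_conv_pow.
  by rewrite cintegral_conv_pow// subr0 /gamma_fun mulrA mulrC [_%:C * _]mulrC.
by rewrite -e1 -e2; exact: cintegral_Fubini.
Qed.

End gamma_beta.

(** * Gamma has no zero on the right half-plane *)

Section gamma_nonvanishing.
Context {R : realType}.
Notation mu := (@lebesgue_measure R).
Implicit Types (x t s : R) (z w : R[i]).

Lemma Re_natr (n : nat) : complex.Re (n%:R : R[i]) = n%:R.
Proof. by rewrite -(rmorph_nat (real_complex R)). Qed.

Lemma Im_natr (n : nat) : complex.Im (n%:R : R[i]) = 0.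
Proof. by rewrite -(rmorph_nat (real_complex R)). Qed.

Lemma ReMr z x : complex.Re (z * x%:C) = complex.Re z * x.
Proof. by rewrite cReM/= mulr0 subr0. Qed.

Lemma ImMr z x : complex.Im (z * x%:C) = complex.Im z * x.
Proof. by rewrite cImM/= mulr0 add0r. Qed.

Lemma Re_cpow t z :
  complex.Re (cpow t z) = t `^ complex.Re z * cos (complex.Im z * ln t).
Proof. by rewrite /cpow cReM/= mul0r subr0. Qed.

Lemma Im_cpow t z :
  complex.Im (cpow t z) = t `^ complex.Re z * sin (complex.Im z * ln t).
Proof. by rewrite /cpow cImM/= mul0r addr0. Qed.

Lemma is_derive_cpow z t : 0 < t ->
  is_derive t 1 (fun u => complex.Re (cpow u z)) (complex.Re (z * cpow t (z - 1))) /\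
  is_derive t 1 (fun u => complex.Im (cpow u z)) (complex.Im (z * cpow t (z - 1))).
Proof.
move=> t0; set p := complex.Re z; set y := complex.Im z.
have d0 := is_derive1_powR p t0.
have d1 : is_derive t 1 (fun u => y * ln u) (y * t^-1) := is_deriveZ y (is_derive1_ln t0).
have dc : is_derive t 1 (fun u => cos (y * ln u)) (- sin (y * ln t) * (y * t^-1)).
  exact: (@is_derive1_comp R cos (fun u => y * ln u) t _ _ (is_derive_cos _) d1).
have ds : is_derive t 1 (fun u => sin (y * ln u)) (cos (y * ln t) * (y * t^-1)).
  exact: (@is_derive1_comp R sin (fun u => y * ln u) t _ _ (is_derive_sin _) d1).
have pE : t `^ p = t * t `^ (p - 1).
  rewrite powRB; last by rewrite (gt_eqF t0) implybT.
  by rewrite powRr1 ?ltW// mulrC divfK// gt_eqF.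
have rz : complex.Re (z - 1) = p - 1 by rewrite cReD.
have iz : complex.Im (z - 1) = y by rewrite cImD/= oppr0 addr0.
have tn0 : t != 0 by rewrite gt_eqF.
split.
- rewrite (_ : (fun u => _) = (fun u => u `^ p * cos (y * ln u))); last first.
    by apply/funext => u; rewrite Re_cpow.
  have [dd dv] := is_deriveM d0 dc.
  split; first exact: dd.
  rewrite [LHS]dv /GRing.scale/= cReM Re_cpow Im_cpow rz iz -/p -/y pE.
  by field.
- rewrite (_ : (fun u => _) = (fun u => u `^ p * sin (y * ln u))); last first.
    by apply/funext => u; rewrite Im_cpow.
  have [dd dv] := is_deriveM d0 ds.
  split; first exact: dd.
  rewrite [LHS]dv /GRing.scale/= cImM Re_cpow Im_cpow rz iz -/p -/y pE.
  by field.
Qed.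

(** [phi] stands for the real or the imaginary part. Re z > 0 makes the antiderivative u^z
    continuous at 0, where the integrand may be unbounded. *)
Lemma FTC_cpow (phi : R[i] -> R) (z : R[i]) : 0 < complex.Re z ->
  (forall w, `|phi w| <= normc w) ->
  mu.-integrable `[0, 1] (EFin \o (fun u => phi (z * pos_pow z u))) ->
  (forall t, 0 < t -> is_derive t 1 (fun u => phi (cpow u z)) (phi (z * cpow t (z - 1)))) ->
  (forall t, 0 < t -> {for t, continuous (fun u => phi (z * cpow u (z - 1)))}) ->
  \int[mu]_(u in `[0, 1]) phi (z * pos_pow z u) = phi 1.
Proof.
move=> z0 phi_le fi dphi cphi.
have phi0 : phi 0 = 0.
  by apply/eqP; rewrite -normr_le0 (le_trans (phi_le 0))// normc0.
have cz0 : cpow 0 z = 0 by rewrite /cpow powR0 ?gt_eqF// mul0r.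
rewrite (@FTC_finite_exceptions R [::] _ (fun u => phi (cpow u z)) 0 1 ler01 fi).
- by rewrite cpow1l cz0 phi0 subr0.
- apply/(continuous_within_itvP _ ltr01); split.
  + move=> t; rewrite in_itv/= => /andP[t0 _].
    by apply: differentiable_continuous; apply/derivable1_diffP; apply: ex_derive; exact: dphi.
  + rewrite cz0 phi0; apply/norm_cvg0P.
    apply: (@squeeze_cvgr _ _ _ _ (fun=> 0) (fun u => u `^ complex.Re z)).
    * by apply: nearW => u; rewrite normr_ge0/= -normc_cpow.
    * exact: cvg_cst.
    * exact: powR_cvg0.
  + apply: cvg_at_left_filter.
    by apply: differentiable_continuous; apply/derivable1_diffP; apply: ex_derive; exact: dphi.
- move=> t; rewrite in_itv/= => /andP[t0 _] _.
  split; last by rewrite /pos_pow t0; exact: dphi.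
  have ct := cphi _ t0; move: ct; rewrite /prop_for /continuous_at/= {2}/pos_pow t0.
  apply: cvg_trans; apply: near_eq_cvg; near=> u.
  by rewrite /pos_pow ifT//; near: u; exact: lt_nbhsr.
Unshelve. all: by end_near. Qed.

(** [pos_pow 1] is the indicator of t > 0, so after reflection the integrand is z u^(z-1) on ]0, 1[,
    with antiderivative u^z. *)
Lemma beta_int1r z : 0 < complex.Re z -> z * beta_int z 1 = 1.
Proof.
move=> z0.
have i1 : cintegrable mu (beta_fun z 1) by apply: cintegrable_beta_fun.
rewrite -cintegralZl// -(cintegral_reflect 1); last exact: cintegrableZl.
have i2 : cintegrable mu (fun u => z * beta_fun z 1 (1 - u)).
  exact: (cintegrable_reflect 1 (cintegrableZl z i1)).
have E u : z * beta_fun z 1 (1 - u) = if u \in `[0, 1[%classic then z * pos_pow z u else 0.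
  rewrite /beta_fun opprB addrC subrK [X in _ * (_ * X)]/pos_pow subr_gt0 subrr cpow0.
  have -> : (u \in `[0, 1[%classic) = (0 <= u) && (u < 1).
    by apply/idP/idP; rewrite inE/= in_itv.
  case: (ltP u 1) => u1; last by rewrite andbF !mulr0.
  rewrite andbT mulr1; case: leP => // u0.
  by rewrite /pos_pow ltNge ltW//= mulr0.
have [i3 i4] := i2.
rewrite (eq_cintegral (h := fun u => if u \in `[0, 1[%classic then z * pos_pow z u else 0)); last by move=> u _.
rewrite -cintegral_mkcond.
have j (phi : R[i] -> R) : phi 0 = 0 ->
    mu.-integrable setT (fun u => (phi (z * beta_fun z 1 (1 - u)))%:E) ->
    mu.-integrable `[0, 1] (EFin \o (fun u => phi (z * pos_pow z u))) /\
    \int[mu]_(u in `[0, 1[) phi (z * pos_pow z u) =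
    \int[mu]_(u in `[0, 1]) phi (z * pos_pow z u).
  move=> phi0 h.
  have h1 : mu.-integrable `[0, 1[ (EFin \o (fun u => phi (z * pos_pow z u))).
    apply/integrable_mkcond => //; move: h; apply: eq_integrable => // u _.
    by rewrite E patchE/=; case: ifP => // _; rewrite phi0.
  split; last exact: Rintegral_itv_bndo_bndc.
  have /integrableP[m1 l1] := h1.
  apply/integrableP; split; first exact/emeasurable_fun_itv_bndo_bndcP.
  rewrite -integral_itv_bndo_bndc//; exact: measurableT_comp.
have [iR eR] := j (@complex.Re R) erefl i3.
have [iI eI] := j (@complex.Im R) erefl i4.
have c1 t : 0 < t -> {for t, continuous (fun u => complex.Re (cpow u (z - 1)))}.
  move=> t0; have [d _] := is_derive_cpow (z - 1) t0.
  by apply: differentiable_continuous; apply/derivable1_diffP; apply: ex_derive; exact: d.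
have c2 t : 0 < t -> {for t, continuous (fun u => complex.Im (cpow u (z - 1)))}.
  move=> t0; have [_ d] := is_derive_cpow (z - 1) t0.
  by apply: differentiable_continuous; apply/derivable1_diffP; apply: ex_derive; exact: d.
rewrite /cintegral eR eI.
have -> : \int[mu]_(u in `[0, 1]) complex.Re (z * pos_pow z u) = 1.
  apply: (FTC_cpow z0 (@le_norm_Re R) iR).
    by move=> t t0; have [] := is_derive_cpow z t0.
  move=> t t0; rewrite /prop_for (_ : (fun u => _) = (fun u =>
    complex.Re z * complex.Re (cpow u (z - 1)) - complex.Im z * complex.Im (cpow u (z - 1)))).
    exact: (cvgB (cvgM (cvg_cst _) (c1 t t0)) (cvgM (cvg_cst _) (c2 t t0))).
  by apply/funext => u; rewrite cReM.
have -> // : \int[mu]_(u in `[0, 1]) complex.Im (z * pos_pow z u) = 0.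
apply: (FTC_cpow z0 (@le_norm_Im R) iI).
  by move=> t t0; have [] := is_derive_cpow z t0.
move=> t t0; rewrite /prop_for (_ : (fun u => _) = (fun u =>
  complex.Re z * complex.Im (cpow u (z - 1)) + complex.Im z * complex.Re (cpow u (z - 1)))).
  exact: (cvgD (cvgM (cvg_cst _) (c2 t t0)) (cvgM (cvg_cst _) (c1 t t0))).
by apply/funext => u; rewrite cImM.
Qed.

(** The Beta relation at w = 1 takes the place of an integration by parts on the half-line. *)
Lemma Gamma_intS z : 0 < complex.Re z -> Gamma_int (z + 1) = z * Gamma_int z.
Proof.
move=> z0; have := Gamma_int_beta z0 (ltr01 : 0 < complex.Re (1 : R[i])).
by rewrite Gamma_int1 mulr1 => ->; rewrite mulrA beta_int1r// mul1r.
Qed.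

Definition rGamma x : R := \int[mu]_t (rpos_pow x t * expR (- t)).

Lemma Gamma_int_real x : Gamma_int x%:C = (rGamma x)%:C.
Proof.
rewrite Gamma_intE -cintegral_real; apply: eq_cintegral => t _.
by rewrite /gamma_fun pos_pow_real rmorphM.
Qed.

Lemma rGammaS x : 0 < x -> rGamma (x + 1) = x * rGamma x.
Proof.
move=> x0; apply: complexI; rewrite rmorphM/= -!Gamma_int_real rmorphD/=.
by rewrite Gamma_intS.
Qed.

(** On [1, 2] the integrand is at least [c]: there t^(x-1) is at least 1 or 2^(x-1), according to
    the sign of x - 1. *)
Lemma rGamma_gt0 x : 0 < x -> 0 < rGamma x.
Proof.
move=> x0; have i := integrable_rpos_powR_expR x0.
pose c : R := Num.min 1 (2 `^ (x - 1)) * expR (- 2).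
have c0 : 0 < c by rewrite mulr_gt0 ?expR_gt0// lt_min ltr01 powR_gt0.
have f0 t : 0 <= rpos_pow x t * expR (- t) by rewrite mulr_ge0 ?expR_ge0 ?rpos_pow_ge0.
have i12 : mu.-integrable `[1, 2] (EFin \o (fun t => rpos_pow x t * expR (- t))).
  by apply: integrableS i.
apply: (@lt_le_trans _ _ (\int[mu]_(t in `[1, 2]) (rpos_pow x t * expR (- t)))); last first.
  rewrite fine_le//.
  - exact: integrable_fin_num i12.
  - exact: integrable_fin_num i.
  - apply: ge0_subset_integral => //; last by move=> t _; rewrite lee_fin.
    by case/integrableP : i.
apply: (@lt_le_trans _ _ (\int[mu]_(t in `[1, 2]) cst c t)).
  rewrite Rintegral_cst//= lebesgue_measure_itv/= lte_fin ltr1n/=.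
  by rewrite mulr_gt0// subr_gt0 ltr1n.
apply: le_Rintegral => //.
  apply: continuous_compact_integrable; first exact: segment_compact.
  by apply: continuous_subspaceT => t; exact: cst_continuous.
move=> t /=; rewrite in_itv/= => /andP[t1 t2].
have t0 : 0 < t by rewrite (lt_le_trans ltr01).
rewrite /c /rpos_pow t0; apply: ler_pM; rewrite ?expR_ge0//.
- rewrite ge_min; case: (leP 1 x) => x1.
    have := @ler_powR _ t t1 0 (x - 1); rewrite powRr0 => -> //.
    by rewrite subr_ge0.
  apply/orP; right; rewrite -(opprB 1) !powRN lef_pV2 ?posrE ?powR_gt0//.
  by apply: ge0_ler_powR; rewrite ?nnegrE// ?subr_ge0 ltW.
- by rewrite ler_expR lerN2.
Qed.

(** The density t^(p-1) exp(-t) peaks at c = p - 1. After rotation by the phase c^(-iy), the real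
    part of the integrand is the density times cos(y ln(t/c)), and [cos_ln_ge] bounds its integral
    below by a positive number. *)
Lemma Gamma_int_neq0_large z : 2 * complex.Im z ^+ 2 < complex.Re z - 1 ->
  Gamma_int z != 0.
Proof.
set y := complex.Im z; set p := complex.Re z => yc.
pose c := p - 1; have c0 : 0 < c.
  by apply: le_lt_trans yc; rewrite mulr_ge0 ?sqr_ge0.
have p0 : 0 < p by rewrite /c in c0; lra.
have p10 : 0 < p + 1 by lra.
apply/eqP => G0.
pose g q t := rpos_pow q t * expR (- t) : R.
pose k := 2 * y ^+ 2.
have [iJ iK] := cintegrable_gamma_fun (p0 : 0 < complex.Re z).
pose J t := complex.Re (gamma_fun z t); pose K t := complex.Im (gamma_fun z t).
have /eqP : Gamma_int z = 0 := G0.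
rewrite Gamma_intE eq_complex => /andP[/eqP J0 /eqP K0].
have {}J0 : \int[mu]_t J t = 0 := J0.
have {}K0 : \int[mu]_t K t = 0 := K0.
(* cos th J + sin th K is the real part of exp(-i th) (J + i K). *)
pose th := y * ln c.
have i1 : mu.-integrable setT (EFin \o (fun t => cos th * J t)) :=
  integrableZl measurableT (cos th) iJ.
have i2 : mu.-integrable setT (EFin \o (fun t => sin th * K t)) :=
  integrableZl measurableT (sin th) iK.
have S0 : \int[mu]_t (cos th * J t + sin th * K t) = 0.
  by rewrite RintegralD// !RintegralZl// J0 K0 !mulr0 addr0.
(* The three terms come from expanding t^c exp(-t) (1 - k (t/c - 2 + c/t)); they are Gamma
   integrands of orders p, p + 1 and c. *)
have j1 : mu.-integrable setT (EFin \o (fun t => (1 + 2 * k) * g p t)) :=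
  integrableZl measurableT (1 + 2 * k) (integrable_rpos_powR_expR p0).
have j2 : mu.-integrable setT (EFin \o (fun t => (k / c) * g (p + 1) t)) :=
  integrableZl measurableT (k / c) (integrable_rpos_powR_expR p10).
have j3 : mu.-integrable setT (EFin \o (fun t => (k * c) * g c t)) :=
  integrableZl measurableT (k * c) (integrable_rpos_powR_expR c0).
have j23 : mu.-integrable setT (EFin \o (fun t => (k / c) * g (p + 1) t + (k * c) * g c t)) :=
  integrableD measurableT j2 j3.
have j : mu.-integrable setT (EFin \o (fun t => (1 + 2 * k) * g p t -
    ((k / c) * g (p + 1) t + (k * c) * g c t))) :=
  integrableB measurableT j1 j23.
have := le_Rintegral measurableT j (integrableD measurableT i1 i2).
rewrite S0 RintegralB// RintegralD// !RintegralZl//;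
  try exact: integrable_rpos_powR_expR.
have -> : \int[mu]_t g p t = rGamma p by [].
have -> : \int[mu]_t g (p + 1) t = rGamma (p + 1) by [].
have -> : \int[mu]_t g c t = rGamma c by [].
have Gc := rGamma_gt0 c0.
have pE : p = c + 1 by rewrite /c subrK.
have GpE : rGamma p = c * rGamma c by rewrite pE rGammaS.
rewrite rGammaS// GpE leNgt => /(_ _)/negP; apply.
  move=> t _.
  rewrite /J /K /gamma_fun /g /pos_pow /rpos_pow.
  case: ifPn => t0; last by rewrite !cReM !cImM/=; lra.
  have rz : complex.Re (z - 1) = c by rewrite cReD.
  have iz : complex.Im (z - 1) = y by rewrite cImD/= oppr0 addr0.
  rewrite ReMr ImMr Re_cpow Im_cpow rz iz.
  have e1 : t `^ (p + 1 - 1) = t * t `^ c.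
    by rewrite addrK pE powRD ?(gt_eqF t0) ?implybT// powRr1 ?ltW// mulrC.
  have e2 : t `^ (c - 1) = t `^ c / t.
    by rewrite powRB ?(gt_eqF t0) ?implybT// powRr1 ?ltW.
  rewrite e1 e2 -/c.
  have := cos_ln_ge y (divr_gt0 t0 c0); rewrite ln_div ?posrE// mulrBr -/th cosB -/k.
  have X0 : 0 <= t `^ c * expR (- t) by rewrite mulr_ge0 ?powR_ge0 ?expR_ge0.
  move=> /(ler_wpM2l X0) h.
  rewrite [leLHS](_ : _ = t `^ c * expR (- t) * (1 - k * (t / c - 2 + (t / c)^-1))); last first.
    by field; rewrite !gt_eqF.
  by apply: le_trans h _; rewrite le_eqVlt; apply/orP; left; apply/eqP; ring.
(* The functional equation reduces all three Gamma values to [rGamma c]; the factor c - k is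
   positive by [yc]. *)
have -> : (1 + 2 * k) * (c * rGamma c) - (k / c * (p * (c * rGamma c)) + k * c * rGamma c)
    = rGamma c * (c - k).
  by rewrite pE; field; rewrite gt_eqF.
by rewrite mulr_gt0// subr_gt0.
Qed.

(** A zero at z would propagate to every z + N, while the shift leaves the imaginary part fixed and
    makes the real part as large as desired. *)
Lemma Gamma_int_neq0 z : 0 < complex.Re z -> Gamma_int z != 0.
Proof.
move=> z0; pose N := (Num.truncn (2 * complex.Im z ^+ 2 + 1)).+1.
have : Gamma_int (z + N%:R) != 0.
  apply: Gamma_int_neq0_large.
  have -> : complex.Im (z + N%:R) = complex.Im z.
    by rewrite cImD Im_natr addr0.
  rewrite cReD Re_natr.
  have : 2 * complex.Im z ^+ 2 + 1 < N%:R by rewrite /N truncnS_gt.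
  lra.
apply: contra => /eqP G0; apply/eqP.
elim: N => [|N IH]; first by rewrite addr0.
rewrite -natr1 addrA Gamma_intS ?IH ?mulr0//.
rewrite cReD Re_natr.
by rewrite ltr_wpDr.
Qed.

End gamma_nonvanishing.

(** * Geometric bounds and Cauchy products of power series *)

Section power_series.
Context {R : realType}.
Implicit Types (r rho : R) (a : nat -> R[i]) (A : R[i] -> R[i]).

Lemma power_series_on_uniform rho a A r : power_series_on rho a A ->
  0 < r < rho -> forall e : R, 0 < e ->
  \forall N \near \oo, forall z, normc z <= r ->
    normc (\sum_(k < N) a k * z ^+ k - A z) <= e.
Proof.
move=> hA rrho e e0; have := hA r rrho.
pose S (N : nat) (z : R[i]) : R[i]^o := \sum_(k < N) a k * z ^+ k.
pose P : set (R[i] -> R[i]^o) := [set g | forall z, normc z <= r -> normc (g z - A z) <= e].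
suff nP : nbhs (A : {uniform` [set z : R[i] | `|z| <= r%:C] -> R[i]^o}) P.
  by move=> /(_ P nP).
apply/uniform_nbhs; exists [set xy : R[i]^o * R[i]^o | `|xy.1 - xy.2| < e%:C]; split.
  by exists e%:C => //=; rewrite ltcR.
move=> g /= h z zr; have := h z; rewrite /= norm_normc lecR => /(_ zr).
by rewrite norm_normc ltcR normcB => /ltW.
Qed.

(** At an intermediate radius r', the terms are differences of consecutive partial sums, both
    eventually within 1 of A(r'). They are therefore bounded, and passing from r' to r gains the
    ratio r/r'. *)
Lemma power_series_on_coef rho a A r : power_series_on rho a A ->
  0 < r < rho -> exists M p : R, [/\ 0 <= M, 0 <= p < 1 &
    forall n, normc (a n) * r ^+ n <= M * p ^+ (2 * n)].
Proof.
move=> hA /andP[r0 rrho]; pose r' := (r + rho) / 2.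
have rr' : r < r' by rewrite /r'; lra.
have r'rho : r' < rho by rewrite /r'; lra.
have r'0 : 0 < r' by exact: lt_trans rr'.
have : 0 < r' < rho by rewrite r'0.
move=> /(power_series_on_uniform hA)/(_ 1 ltr01)[N0 _ hN0].
have bound n : (N0 <= n)%N -> normc (a n) * r' ^+ n <= 2.
  move=> Nn; have nr' : normc r'%:C <= r' by rewrite normc_real (ger0_norm (ltW r'0)).
  have := hN0 n Nn _ nr'; have := hN0 n.+1 (leqW Nn) _ nr'.
  rewrite big_ord_recr/=; set S := \sum_(_ < _) _ => h1 h2.
  have -> : normc (a n) * r' ^+ n = normc (a n * r'%:C ^+ n).
    by rewrite normcM normcX normc_real (ger0_norm (ltW r'0)).
  have -> : a n * r'%:C ^+ n = (S + a n * r'%:C ^+ n - A r'%:C) + (A r'%:C - S) by ring.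
  by rewrite (le_trans (le_normcD _ _))// [X in _ + X]normcB -[2]/(1 + 1) lerD.
pose M : R := 2 + \sum_(k < N0) normc (a k) * r' ^+ k.
have sum0 : 0 <= \sum_(k < N0) normc (a k) * r' ^+ k.
  by apply: sumr_ge0 => k _; rewrite mulr_ge0 ?normc_ge0 ?exprn_ge0 ?(ltW r'0).
have boundM n : normc (a n) * r' ^+ n <= M.
  have [/bound h|nN] := leqP N0 n; first by rewrite /M; lra.
  rewrite /M (bigD1 (Ordinal nN))//= addrCA lerDl.
  by rewrite addr_ge0// sumr_ge0// => k _; rewrite mulr_ge0 ?normc_ge0 ?exprn_ge0 ?(ltW r'0).
(* The square root turns (r/r')^n into p^(2n), the shape used by [cauchy_product_tail]. *)
exists M, (Num.sqrt (r / r')); split; first by rewrite /M; lra.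
  rewrite sqrtr_ge0/= -[ltRHS]sqrtr1 ltr_sqrt// ltr_pdivrMr// mul1r//.
move=> n; rewrite exprM sqr_sqrtr; last by rewrite divr_ge0 ?(ltW r0) ?(ltW r'0).
rewrite exprMn exprVn mulrA ler_pdivlMr ?exprn_gt0//.
by rewrite mulrAC ler_wpM2r ?exprn_ge0 ?(ltW r0).
Qed.

Lemma geometric_sum_le (p : R) (N : nat) : 0 <= p < 1 ->
  \sum_(k < N) p ^+ k <= (1 - p)^-1.
Proof.
move=> /andP[p0 p1]; rewrite -div1r ler_pdivlMr ?subr_gt0//.
have -> : (\sum_(k < N) p ^+ k) * (1 - p) = 1 - p ^+ N.
  elim: N => [|N IH]; first by rewrite big_ord0 mul0r expr0 subrr.
  by rewrite big_ord_recr/= mulrDl IH exprS; ring.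
by rewrite gerBl exprn_ge0.
Qed.

Lemma partial_sum_le (c : nat -> R[i]) (M p : R) (N : nat) : 0 <= M -> 0 <= p < 1 ->
  (forall n, normc (c n) <= M * p ^+ (2 * n)) ->
  \sum_(k < N) normc (c k) <= M / (1 - p).
Proof.
move=> M0 p01 hc; rewrite (@le_trans _ _ (\sum_(k < N) M * p ^+ k))//.
  apply: ler_sum => k _; rewrite (le_trans (hc k))// ler_wpM2l//.
  have /andP[p0 p1] := p01.
  by rewrite ler_wiXn2l ?(ltW p1)// mul2n -addnn leq_addr.
by rewrite -mulr_sumr ler_wpM2l// geometric_sum_le.
Qed.

Lemma triangular_sum (V : zmodType) (F : nat -> nat -> V) (N : nat) :
  \sum_(n < N) \sum_(m < N - n) F n m = \sum_(j < N) \sum_(n < j.+1) F n (j - n)%N.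
Proof.
elim: N => [|N IH]; first by rewrite !big_ord0.
rewrite [RHS]big_ord_recr/= -IH.
transitivity (\sum_(n < N.+1) (\sum_(m < N - n) F n m + F n (N - n)%N)).
  apply: eq_bigr => n _; rewrite subSn ?big_ord_recr//= -ltnS; exact: ltn_ord.
rewrite big_split/=; congr (_ + _).
by rewrite big_ord_recr/= subnn big_ord0 addr0.
Qed.

(* Writing the bounds as [p ^ (2 n)] leaves a factor [p ^ N] over each term with
   [N <= n + m], after a convergent double series has been split off. *)
Lemma cauchy_product_tail (u v : nat -> R[i]) (Mu Mv p : R) (N : nat) :
  0 <= Mu -> 0 <= Mv -> 0 <= p < 1 ->
  (forall n, normc (u n) <= Mu * p ^+ (2 * n)) ->
  (forall n, normc (v n) <= Mv * p ^+ (2 * n)) ->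
  normc ((\sum_(n < N) u n) * (\sum_(n < N) v n) -
         \sum_(j < N) \sum_(n < j.+1) u n * v (j - n)%N) <=
  Mu / (1 - p) * (Mv / (1 - p)) * p ^+ N.
Proof.
move=> Mu0 Mv0 p01 hu hv; have /andP[p0 p1] := p01.
rewrite -(triangular_sum (fun n m => u n * v m)).
rewrite mulr_suml -sumrB.
under eq_bigr do rewrite mulr_sumr.
have E (n : 'I_N) : \sum_(m < N) u n * v m - \sum_(m < N - n) u n * v m =
    \sum_(N - n <= m < N) u n * v m.
  rewrite -!(big_mkord xpredT (fun m => u n * v m)).
  by rewrite (@big_cat_nat _ _ _ (N - n)%N)//= ?leq_subr// addrC addrK.
under eq_bigr do rewrite E.
rewrite (le_trans (normc_sum _ _ _))//.
apply: (@le_trans _ _ (\sum_(n < N) \sum_(m < N) (Mu * p ^+ n) * ((Mv * p ^+ m) * p ^+ N))).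
  apply: ler_sum => n _; rewrite (le_trans (normc_sum _ _ _))//.
  rewrite -(big_mkord xpredT (fun m => (Mu * p ^+ n) * ((Mv * p ^+ m) * p ^+ N))).
  rewrite [leRHS](@big_cat_nat _ _ _ (N - n)%N)//= ?leq_subr//.
  rewrite -[leLHS]add0r lerD//.
    by apply: sumr_ge0 => m _; rewrite !mulr_ge0 ?exprn_ge0.
  apply: ler_sum_nat => m /andP[Nnm mN].
  rewrite normcM (le_trans (ler_pM (normc_ge0 _) (normc_ge0 _) (hu n) (hv m)))//.
  rewrite !mulrA -![_ * _ * Mv]mulrAC -!mulrA !ler_wpM2l//.
  rewrite -!exprD ler_wiXn2l ?(ltW p1)//.
  by rewrite !mul2n -!addnn; move: Nnm; rewrite leq_subLR; lia.
under eq_bigr do rewrite -mulr_sumr -mulr_suml.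
rewrite -mulr_suml mulrA ler_wpM2r ?exprn_ge0// -!mulr_sumr.
by rewrite ler_pM ?mulr_ge0 ?sumr_ge0 ?ler_wpM2l ?geometric_sum_le// => k _; rewrite exprn_ge0.
Qed.

End power_series.

(** * The fractional kernels and their convolution *)

Section kernel.
Context {R : realType}.
Notation mu := (@lebesgue_measure R).
Variables (beta : R[i]) (l : R).
Hypotheses (beta0 : 0 <= complex.Re beta) (l0 : 0 < l).
Implicit Types (alpha rho v s t : R) (a : nat -> R[i]) (A : R[i] -> R[i]).

Let r := l `^ complex.Re beta.

Let r0 : 0 < r. Proof. exact: powR_gt0. Qed.

Lemma normc_cpow_le v : 0 < v <= l -> normc (cpow v beta) <= r.
Proof.
move=> /andP[v0 vl]; rewrite normc_cpow; apply: ge0_ler_powR => //.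
- by rewrite nnegrE ltW.
- by rewrite nnegrE ltW.
Qed.

(** The cut-off at [l] keeps v^beta in the disc of radius [r], where [A] is the sum of its series;
    the cut-off at 0 makes the fractional integral a convolution on the line. *)
Definition kernel alpha A v : R[i] :=
  if 0 < v <= l then pos_pow alpha%:C v * A (cpow v beta) else 0.

Section one_kernel.
Variables (alpha rho : R) (a : nat -> R[i]) (A : R[i] -> R[i]).
Hypotheses (alpha0 : 0 < alpha) (rrho : r < rho) (hA : power_series_on rho a A).

Let r0rho : 0 < r < rho. Proof. by rewrite r0. Qed.

Lemma power_series_bounded :
  exists2 C : R, 0 <= C & forall z, normc z <= r -> normc (A z) <= C.
Proof.
have [M [p [M0 p01 hM]]] := power_series_on_coef hA r0rho.
have /andP[p0 p1] := p01.
exists (1 + M / (1 - p)).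
  by rewrite addr_ge0// divr_ge0// subr_ge0 ltW.
move=> z zr; have [N _ /(_ _ (leqnn N))] := power_series_on_uniform hA r0rho ltr01.
move=> /(_ z zr) h.
have -> : A z = (A z - \sum_(k < N) a k * z ^+ k) + \sum_(k < N) a k * z ^+ k by rewrite subrK.
rewrite (le_trans (le_normcD _ _))// lerD//; first by rewrite normcB.
rewrite (le_trans (normc_sum _ _ _))//.
apply: (partial_sum_le (c := fun k => a k * z ^+ k)) => // n.
rewrite normcM normcX; apply: le_trans (hM n).
by rewrite ler_wpM2l ?normc_ge0// lerXn2r// nnegrE ?normc_ge0// ltW.
Qed.

Lemma kernel_le : exists2 C : R, 0 <= C &
  forall v, normc (kernel alpha A v) <= C * (if v <= l then rpos_pow alpha v else 0).
Proof.
have [C C0 hC] := power_series_bounded; exists C => // v.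
rewrite /kernel; case: ifPn => [vl|vl].
  have /andP[v0 ->] := vl.
  rewrite normcM normc_pos_pow/= mulrC ler_wpM2r ?rpos_pow_ge0//.
  by apply: hC; exact: normc_cpow_le.
by rewrite normc0 mulr_ge0//; case: ifP => // _; exact: rpos_pow_ge0.
Qed.

Lemma cmeasurable_kernel : cmeasurable (kernel alpha A).
Proof.
pose k_ (N : nat) v : R[i] := if 0 < v <= l then
  pos_pow alpha%:C v * \sum_(k < N) a k * cpow v beta ^+ k else 0.
have mk N : cmeasurable (k_ N).
  apply: cmeasurable_if; last exact: cmeasurable_cst.
    by apply: measurable_and; [exact: measurable_fun_ltr|exact: measurable_fun_ler].
  apply: cmeasurableM; first exact: cmeasurable_pos_pow.
  apply: cmeasurable_sum => k; apply: cmeasurableM; first exact: cmeasurable_cst.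
  by apply: cmeasurableX; exact: cmeasurable_cpow.
have ck v (e : R) : 0 < e -> \forall N \near \oo, normc (k_ N v - kernel alpha A v) <= e.
  move=> e0; rewrite /k_ /kernel; case: ifPn => vl; last first.
    by apply: nearW => N; rewrite subrr normc0 ltW.
  have q0 : 0 < 1 + rpos_pow alpha v by rewrite ltr_wpDr ?rpos_pow_ge0.
  have := power_series_on_uniform hA r0rho (divr_gt0 e0 q0).
  apply: filterS => N /(_ (cpow v beta) (normc_cpow_le vl)) h.
  rewrite -mulrBr normcM normc_pos_pow/=.
  apply: (@le_trans _ _ ((1 + rpos_pow alpha v) * (e / (1 + rpos_pow alpha v)))).
    by apply: ler_pM; rewrite ?rpos_pow_ge0 ?normc_ge0// lerDr.
  by rewrite mulrC divfK// gt_eqF.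
split.
- apply: (measurable_fun_cvg (h := fun N v => complex.Re (k_ N v))).
    by move=> N; case: (mk N).
  move=> v _; apply/cvgrPdist_le => e /(ck v).
  apply: filterS => N; apply: le_trans.
  by rewrite distrC (_ : _ - _ = complex.Re (k_ N v - kernel alpha A v)) ?le_norm_Re// cReD; case: (kernel _ _ _).
- apply: (measurable_fun_cvg (h := fun N v => complex.Im (k_ N v))).
    by move=> N; case: (mk N).
  move=> v _; apply/cvgrPdist_le => e /(ck v).
  apply: filterS => N; apply: le_trans.
  by rewrite distrC (_ : _ - _ = complex.Im (k_ N v - kernel alpha A v)) ?le_norm_Im// cImD; case: (kernel _ _ _).
Qed.

Lemma cintegrable_kernel : cintegrable mu (kernel alpha A).
Proof.
have [C C0 hC] := kernel_le.
(* For v <= l, 1 <= exp(l) exp(-v), so a Gamma integrand dominates the kernel. *)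
have i := integrableZl measurableT (C * expR l) (integrable_rpos_powR_expR alpha0).
apply: (@cintegrable_le _ _ _ mu _ (fun v => C * expR l * (rpos_pow alpha v * expR (- v)))) => //.
  exact: cmeasurable_kernel.
move=> v; apply: le_trans (hC v) _; rewrite -mulrA ler_wpM2l//.
case: ifPn => vl; last by rewrite !mulr_ge0 ?expR_ge0 ?rpos_pow_ge0.
rewrite mulrCA ler_peMr ?rpos_pow_ge0// -expRD.
by rewrite -[leLHS]expR0 ler_expR subr_ge0.
Qed.

End one_kernel.

Section two_kernels.
Variables (alpha : R) (a b : nat -> R[i]) (A B : R[i] -> R[i]) (rho rho' : R).
Hypotheses (alpha01 : 0 < alpha < 1) (rrho : r < rho) (rrho' : r < rho').
Hypotheses (hA : power_series_on rho a A) (hB : power_series_on rho' b B).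
Hypothesis hinv : Gamma_inverse alpha beta a b.

Let alpha0 : 0 < alpha. Proof. by case/andP : alpha01. Qed.
Let alpha1 : 0 < 1 - alpha. Proof. by case/andP : alpha01; rewrite subr_gt0. Qed.

(** Two independent points are needed, because the factors of the convolution are evaluated at (t -
    u)^beta and (u - s)^beta. *)
Lemma cauchy_product_uniform (e : R) : 0 < e ->
  \forall N \near \oo, forall X Y, normc X <= r -> normc Y <= r ->
  normc (A X * B Y - \sum_(j < N) \sum_(n < j.+1)
    a n * X ^+ n * (b (j - n)%N * Y ^+ (j - n))) <= e.
Proof.
move=> e0.
have ra : 0 < r < rho by rewrite r0.
have rb : 0 < r < rho' by rewrite r0.
have [CA CA0 hCA] := power_series_bounded rrho hA.
have [Ma [pa [Ma0 pa01 hMa]]] := power_series_on_coef hA ra.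
have [Mb [pb [Mb0 pb01 hMb]]] := power_series_on_coef hB rb.
pose p := Num.max pa pb.
have p01 : 0 <= p < 1.
  by rewrite le_max gt_max; case/andP : pa01 => -> ->; case/andP : pb01 => _ ->.
have /andP[p0 p1] := p01.
have pap : pa <= p by rewrite le_max lexx.
have pbp : pb <= p by rewrite le_max lexx orbT.
have {hMa} hMa X n : normc X <= r -> normc (a n * X ^+ n) <= Ma * p ^+ (2 * n).
  move=> Xr; rewrite normcM normcX; apply: (@le_trans _ _ (normc (a n) * r ^+ n)).
    by rewrite ler_wpM2l ?normc_ge0// lerXn2r// nnegrE ?normc_ge0// ltW.
  apply: le_trans (hMa n) _; rewrite ler_wpM2l// lerXn2r// nnegrE//.
  by case/andP : pa01.
have {hMb} hMb X n : normc X <= r -> normc (b n * X ^+ n) <= Mb * p ^+ (2 * n).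
  move=> Xr; rewrite normcM normcX; apply: (@le_trans _ _ (normc (b n) * r ^+ n)).
    by rewrite ler_wpM2l ?normc_ge0// lerXn2r// nnegrE ?normc_ge0// ltW.
  apply: le_trans (hMb n) _; rewrite ler_wpM2l// lerXn2r// nnegrE//.
  by case/andP : pb01.
pose K := Ma / (1 - p) * (Mb / (1 - p)).
have q0 : 0 < 1 - p by rewrite subr_gt0.
have K0 : 0 <= K by rewrite !mulr_ge0 ?invr_ge0 ?(ltW q0).
pose D := 1 + CA + Mb / (1 - p) + K.
have Mbq : 0 <= Mb / (1 - p) by rewrite mulr_ge0 ?invr_ge0 ?(ltW q0).
have D0 : 0 < D by rewrite /D; lra.
(* [D] is positive and exceeds the sum of the three constants that multiply [d] in the final error
   bound. *)
pose d := e / (3 * D).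
have d0 : 0 < d by rewrite divr_gt0// mulr_gt0.
near=> N => X Y Xr Yr.
set SA := \sum_(n < N) a n * X ^+ n; set SB := \sum_(n < N) b n * Y ^+ n.
have h1 : normc (SA - A X) <= d.
  by move: X Xr @SA; near: N; exact: (power_series_on_uniform hA ra d0).
have h2 : normc (SB - B Y) <= d.
  by move: Y Yr @SB; near: N; exact: (power_series_on_uniform hB rb d0).
have h3 := cauchy_product_tail N Ma0 Mb0 p01 (fun n => hMa X n Xr) (fun n => hMb Y n Yr).
have h4 : p ^+ N <= d.
  near: N.
  have : (fun N => p ^+ N) @ \oo --> (0 : R) by apply: cvg_expr; rewrite ger0_norm.
  move=> /cvgrPdist_le/(_ d d0); apply: filterS => N.
  by rewrite sub0r normrN ger0_norm ?exprn_ge0.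
have h5 : normc SB <= Mb / (1 - p).
  rewrite (le_trans (normc_sum _ _ _))//.
  by apply: (partial_sum_le (c := fun k => b k * Y ^+ k)) => // n; exact: hMb.
move: h3; rewrite -/SA -/SB; set T := \sum_(j < N) _ => h3.
have -> : A X * B Y - T = A X * (B Y - SB) + (A X - SA) * SB + (SA * SB - T) by ring.
apply: (@le_trans _ _ (CA * d + d * (Mb / (1 - p)) + K * d)).
  rewrite !(le_trans (le_normcD _ _))// !lerD//.
  - rewrite (le_trans (le_normcD _ _))// lerD//.
      by rewrite normcM ler_pM ?normc_ge0 ?hCA// normcB.
    by rewrite normcM ler_pM ?normc_ge0// normcB.
  - by apply: le_trans h3 _; rewrite ler_wpM2l.
have -> : CA * d + d * (Mb / (1 - p)) + K * d = (CA + Mb / (1 - p) + K) * d by ring.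
rewrite /d mulrA ler_pdivrMr ?mulr_gt0// mulrC ler_wpM2l ?(ltW e0)// /D; lra.
Unshelve. all: by end_near. Qed.

Let Re_exponent (n : nat) : complex.Re (beta * n%:R) = complex.Re beta * n%:R.
Proof. by rewrite cReM Re_natr Im_natr mulr0 subr0. Qed.

Let Re_exponent_ge0 (n : nat) : 0 <= complex.Re (beta * n%:R).
Proof. by rewrite Re_exponent mulr_ge0. Qed.

Let za n : R[i] := beta * n%:R + alpha%:C.
Let zb n : R[i] := beta * n%:R + (1 - alpha)%:C.

Let Re_za n : 0 < complex.Re (za n).
Proof. by rewrite /za cReD ltr_wpDl. Qed.

Let Re_zb n : 0 < complex.Re (zb n).
Proof. by rewrite /zb cReD ltr_wpDl. Qed.

Lemma pos_pow_shift (n : nat) (q v : R) : 0 < v ->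
  pos_pow (beta * n%:R + q%:C) v = pos_pow q%:C v * cpow v beta ^+ n.
Proof.
by move=> v0; rewrite /pos_pow v0 -addrA (@cpowD R v (beta * n%:R)) // cpowMn// mulrC.
Qed.

(** Terms of total degree below [N] in the product of the two kernels. The terms are pure powers
    without cut-off at [l], so that the Beta integral applies to each. *)
Definition triangle_kernel (N : nat) (s t u : R) : R[i] :=
  \sum_(j < N) \sum_(n < j.+1)
    a n * b (j - n)%N * (pos_pow (za n) (t - u) * pos_pow (zb (j - n)) (u - s)).

Lemma cintegrable_triangle N s t : cintegrable mu (triangle_kernel N s t).
Proof.
apply: cintegrable_sum => j; apply: cintegrable_sum => n; apply: cintegrableZl.
exact: cintegrable_conv_pow.
Qed.

(** In degree j all terms share the parameter w = beta j + 1, so the Beta relation leaves the j-th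
    coefficient of A_Gamma times Abar_Gamma over Gamma w. Only degree 0 survives, and [N.+1] ensures
    that it is present. *)
Lemma cintegral_triangle N s t : s < t ->
  cintegral setT (triangle_kernel N.+1 s t) = 1.
Proof.
move=> st; rewrite cintegral_sum; last first.
  by move=> j; apply: cintegrable_sum => n; apply: cintegrableZl; exact: cintegrable_conv_pow.
have E (j : nat) : cintegral setT (fun u => \sum_(n < j.+1)
    a n * b (j - n)%N * (pos_pow (za n) (t - u) * pos_pow (zb (j - n)) (u - s))) =
    (j == 0%N)%:R.
  pose w := beta * j%:R + 1.
  have w0 : 0 < complex.Re w by rewrite cReD/= ltr_wpDl.
  have zw n : (n <= j)%N -> za n + zb (j - n) = w.
    move=> nj; rewrite /za /zb /w addrACA -mulrDr -natrD subnKC//.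
    by congr (_ + _); rewrite -rmorphD/= addrC subrK.
  rewrite cintegral_sum; last by move=> n; apply: cintegrableZl; exact: cintegrable_conv_pow.
  transitivity (pos_pow w (t - s) / Gamma_int w * \sum_(n < j.+1)
     Gamma_coef alpha beta a n * Gamma_coef (1 - alpha) beta b (j - n)%N).
    rewrite mulr_sumr; apply: eq_bigr => n _.
    rewrite cintegralZl; last exact: cintegrable_conv_pow.
    have nj : (n <= j)%N by rewrite -ltnS.
    rewrite cintegral_conv_pow// zw// /Gamma_coef /Gamma -/(za n) -/(zb _) Re_za Re_zb.
    rewrite [X in _ = _ * X]mulrACA Gamma_int_beta// zw//.
    by field; exact: Gamma_int_neq0.
  rewrite hinv; case: eqP => [j0|_]; last by rewrite mulr0.
  rewrite mulr1 /w j0 mulr0 add0r Gamma_int1 divr1 /pos_pow subr_gt0 st.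
  by rewrite subrr cpow0.
under eq_bigr do rewrite E.
by rewrite big_ord_recl/= big1 ?addr0.
Qed.

Lemma kernel_convolution s t : s < t -> t - s <= l ->
  cintegrable mu (fun u => kernel alpha A (t - u) * kernel (1 - alpha) B (u - s)) /\
  cintegral setT (fun u => kernel alpha A (t - u) * kernel (1 - alpha) B (u - s)) = 1.
Proof.
move=> st tsl.
pose G u := rpos_pow alpha (t - u) * rpos_pow (1 - alpha) (u - s).
have iG : mu.-integrable setT (EFin \o G).
  have := integrable_normc (cintegrable_conv_pow (z := alpha%:C) (w := (1 - alpha)%:C) t s alpha0 alpha1).
  by apply: eq_integrable => // u _ /=; rewrite normcM !normc_pos_pow.
set H := fun u => _ * _.
have mH : cmeasurable H.
  apply: cmeasurableM.
    apply: (cmeasurable_comp (g := kernel alpha A)); last exact: measurable_funB.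
    exact: (cmeasurable_kernel _ rrho hA).
  apply: (cmeasurable_comp (g := kernel (1 - alpha) B)); last exact: measurable_funB.
  exact: (cmeasurable_kernel _ rrho' hB).
have iH : cintegrable mu H.
  have [C C0 hC] := kernel_le alpha rrho hA.
  have [C' C'0 hC'] := kernel_le (1 - alpha) rrho' hB.
  apply: (@cintegrable_le _ _ _ mu _ (fun u => (C * C') * G u)) => //.
    exact: (integrableZl measurableT (C * C') iG).
  move=> u; rewrite normcM /G mulrACA; apply: ler_pM; rewrite ?normc_ge0//.
    apply: le_trans (hC _) _; rewrite ler_wpM2l//.
    by case: ifP => // _; exact: rpos_pow_ge0.
  apply: le_trans (hC' _) _; rewrite ler_wpM2l//.
  by case: ifP => // _; exact: rpos_pow_ge0.
split => //; apply/eqP; rewrite -subr_eq0; apply/eqP; apply: eq0_normc.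
pose I := \int[mu]_u G u.
have I0 : 0 <= I by apply: Rintegral_ge0 => u _; rewrite mulr_ge0 ?rpos_pow_ge0.
apply/eqP; rewrite eq_le normc_ge0 andbT; apply/ler_addgt0Pl => e e0; rewrite addr0.
(* The 2 offsets the factor in [normc_cintegral_le]; 1 + I is positive even if I = 0. *)
pose d := e / (2 * (1 + I)).
have d0 : 0 < d by rewrite divr_gt0// mulr_gt0// ltr_wpDr.
have [N0 _ hN0] := cauchy_product_uniform d0.
have := hN0 N0.+1 (leqnSn _) => {}hN0.
rewrite -(cintegral_triangle N0 st) -cintegralB//; last exact: cintegrable_triangle.
have iT := cintegrable_triangle N0.+1 s t.
apply: (@le_trans _ _ (2 * \int[mu]_u (d * G u))).
  apply: normc_cintegral_le.
  - have := cintegrableD iH (cintegrableZl (-1) iT).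
    by under eq_fun do rewrite mulN1r.
  - exact: (integrableZl measurableT d iG).
  move=> u.
  have [ut|ut] := leP t u.
    rewrite /H /kernel subr_gt0 ltNge ut/= mul0r.
    rewrite /triangle_kernel big1 ?subrr ?normc0; last first.
      move=> j _; rewrite big1// => n _.
      by rewrite [pos_pow _ (t - u)]/pos_pow subr_gt0 ltNge ut/= mul0r mulr0.
    by rewrite mulr_ge0 ?(ltW d0)// mulr_ge0 ?rpos_pow_ge0.
  have [us|us] := leP u s.
    rewrite /H [X in _ * X]/kernel subr_gt0 ltNge us/= mulr0.
    rewrite /triangle_kernel big1 ?subrr ?normc0; last first.
      move=> j _; rewrite big1// => n _.
      by rewrite [pos_pow _ (u - s)]/pos_pow subr_gt0 ltNge us/= !mulr0.
    by rewrite mulr_ge0 ?(ltW d0)// mulr_ge0 ?rpos_pow_ge0.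
  (* Between s and t both distances are at most t - s <= l, so the cut-off at [l] is invisible. *)
  have tu : 0 < t - u <= l by rewrite subr_gt0 ut/=; lra.
  have su : 0 < u - s <= l by rewrite subr_gt0 us/=; lra.
  have /andP[tu0 _] := tu; have /andP[su0 _] := su.
  rewrite /H /kernel tu su.
  rewrite (_ : triangle_kernel _ _ _ _ = pos_pow alpha%:C (t - u) * pos_pow (1 - alpha)%:C (u - s) *
    \sum_(j < N0.+1) \sum_(n < j.+1)
      a n * cpow (t - u) beta ^+ n * (b (j - n)%N * cpow (u - s) beta ^+ (j - n))); last first.
    rewrite mulr_sumr; apply: eq_bigr => j _; rewrite mulr_sumr; apply: eq_bigr => n _.
    by rewrite /za /zb !pos_pow_shift//; ring.
  rewrite mulrACA -mulrBr normcM normcM !normc_pos_pow/= mulrC ler_wpM2r//.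
    by rewrite mulr_ge0 ?rpos_pow_ge0.
  by apply: hN0; exact: normc_cpow_le.
have I1 : 0 < 1 + I by rewrite ltr_wpDr.
rewrite RintegralZl// -/I (_ : _ * _ = e * (I / (1 + I))); last first.
  by rewrite /d; field; rewrite gt_eqF.
by rewrite ler_piMr ?(ltW e0)// ler_pdivrMr// mul1r lerDr.
Qed.

End two_kernels.
End kernel.

(** * Boundedness, measurability and primitives of piecewise regular functions *)

Section piecewise.
Context {R : realType}.
Notation mu := (@lebesgue_measure R).

Lemma normr_entry_le (n : nat) (v : 'rV[R]_n) (i : 'I_n) : `|v ord0 i| <= `|v|.
Proof. by rewrite [leRHS]/Num.Def.normr/= mx_normrE; exact: (le_bigmax _ _ (ord0, i)). Qed.

Lemma normr_row_le (n : nat) (v : 'rV[R]_n) (c : R) : 0 <= c ->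
  (forall i, `|v ord0 i| <= c) -> `|v| <= c.
Proof.
move=> c0 vc; rewrite [leLHS]/Num.Def.normr/= mx_normrE bigmax_le// => -[i j] _ /=.
by rewrite (ord1 i).
Qed.

(** Each one-sided limit bounds [g] on its side. The value at [x] is unconstrained and enters the
    maximum separately. *)
Lemma piecewise_continuous_near_bounded (V : normedModType R) (a b : R)
    (g : R -> V) (x : R) : piecewise_continuous a b g -> x \in `[a, b] ->
  exists B : R, \forall s \near x, s \in `[a, b] -> `|g s| <= B.
Proof.
move=> [_ gr gl] xab.
have [Br hr] : exists Br : R, \forall s \near x, x < s -> s \in `[a, b] -> `|g s| <= Br.
  have [xb|bx] := ltP x b; last first.
    exists 0; near=> s => xs; rewrite in_itv/= => /andP[_ sb].
    by move: (lt_le_trans xs sb); rewrite ltNge bx.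
  have /gr /cvg_ex[l gxl] : x \in `[a, b[.
    by move: xab; rewrite !in_itv/= xb => /andP[->].
  have ll : `|l| < `|l| + 1 by rewrite ltrDl.
  exists (`|l| + 1).
  have h : \forall s \near x, x < s -> `|g s| <= `|l| + 1 := cvgr_norm_le l gxl _ ll.
  by near=> s => xs _; move: xs; near: s; exact: h.
have [Bl hl] : exists Bl : R, \forall s \near x, s < x -> s \in `[a, b] -> `|g s| <= Bl.
  have [ax|xa] := ltP a x; last first.
    exists 0; near=> s => xs; rewrite in_itv/= => /andP[sa _].
    by move: (lt_le_trans xs xa); rewrite ltNge sa.
  have /gl /cvg_ex[l gxl] : x \in `]a, b].
    by move: xab; rewrite !in_itv/= ax => /andP[_ ->].
  have ll : `|l| < `|l| + 1 by rewrite ltrDl.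
  exists (`|l| + 1).
  have h : \forall s \near x, s < x -> `|g s| <= `|l| + 1 := cvgr_norm_le l gxl _ ll.
  by near=> s => xs _; move: xs; near: s; exact: h.
exists (Num.max `|g x| (Num.max Br Bl)); near=> s => sab.
have [xs|sx|<-] := ltgtP x s; last by rewrite le_max lexx.
- rewrite !le_max; apply/orP; right; apply/orP; left.
  by move: xs sab; near: s; exact: hr.
- rewrite !le_max; apply/orP; right; apply/orP; right.
  by move: sx sab; near: s; exact: hl.
Unshelve. all: by end_near. Qed.

(** Compactness in near-covering form: around each point all large enough B are bounds, hence some B
    is a bound on the whole segment. *)
Lemma piecewise_continuous_bounded (V : normedModType R) (a b : R) (g : R -> V) :
  piecewise_continuous a b g ->
  exists2 B : R, 0 <= B & forall t, t \in `[a, b] -> `|g t| <= B.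
Proof.
move=> pc; have := compact_near_coveringP `[a, b]%classic; move=> [+ _].
move=> /(_ (@segment_compact R a b)).
move=> /(_ R (+oo : set_system R)%R (fun B s => s \in `[a, b] -> `|g s| <= B) _).
have loc x : `[a, b]%classic x ->
    \forall x' \near x & B \near +oo, x' \in `[a, b] -> `|g x'| <= B.
  move=> xab; have [B0 hB0] := piecewise_continuous_near_bounded pc xab.
  near=> s B => /= sab; apply: (@le_trans _ _ B0); last by near: B; apply: nbhs_pinfty_ge; exact: num_real.
  by move: sab; near: s; exact: hB0.
move=> /(_ loc) h.
near (+oo : set_system R)%R => B.
exists B; first by near: B; apply: nbhs_pinfty_ge; exact: num_real.
by move=> t tab; apply: (near h B) => //.
Unshelve. all: by end_near. Qed.

Lemma measurable_fun_finite (s : seq R) (f : R -> R) : measurable_fun [set` s] f.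
Proof.
elim: s => [|p s IH]; first by rewrite set_nil; exact: measurable_fun_set0.
have -> : [set` p :: s] = [set p] `|` [set` s] :> set R.
  apply/seteqP; split => t /=; first by rewrite inE => /orP[/eqP|]; [left|right].
  by move=> [->|ts]; rewrite inE ?eqxx ?ts ?orbT.
apply/measurable_funU => //; last by split => //; exact: measurable_fun_set1.
apply: closed_measurable.
exact: (accessible_finite_set_closed.1 (hausdorff_accessible (@Rhausdorff R)) _ (finite_seq s)).
Qed.

(** Removing the endpoints and the exceptional points leaves an open set of continuity; on the
    finite remainder every function is measurable. *)
Lemma measurable_continuous_off_finite (a b : R) (s : seq R) (f : R -> R) :
  (forall t, t \in `]a, b[ -> t \notin s -> {for t, continuous f}) ->
  measurable_fun `[a, b] f.
Proof.
move=> cf; pose s' := [:: a, b & s].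
have oD : open (`]a, b[%classic `\` [set` s']).
  rewrite setDE; apply: openI; first exact: interval_open.
  apply: closed_openC.
  exact: (accessible_finite_set_closed.1 (hausdorff_accessible (@Rhausdorff R)) _ (finite_seq s')).
apply: (@measurable_funS _ _ _ _ ((`]a, b[%classic `\` [set` s']) `|` [set` s'])).
- apply: measurableU; first exact: open_measurable.
  apply: closed_measurable.
  exact: (accessible_finite_set_closed.1 (hausdorff_accessible (@Rhausdorff R)) _ (finite_seq s')).
- move=> t /=; rewrite !in_itv/= => /andP[at_ tb].
  have [ts|ts] := boolP (t \in s'); [by right|left; split => //].
    move: ts; rewrite !inE !negb_or => /and3P[ta tb' _].
    by rewrite !lt_neqAle at_ tb eq_sym ta tb'.
apply/measurable_funU.
- exact: open_measurable.
- apply: closed_measurable.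
  exact: (accessible_finite_set_closed.1 (hausdorff_accessible (@Rhausdorff R)) _ (finite_seq s')).
split; last exact: measurable_fun_finite.
apply: open_continuous_measurable_fun => // t; rewrite inE => -[/= tab ts].
apply: cf => //; apply/negP => h; apply: ts; rewrite /s' !inE h !orbT//.
Qed.

Lemma piecewise_C1_coord (n : nat) (a b : R) (x : R -> 'rV[R]_n) (i : 'I_n) :
  a < b -> piecewise_C1 a b x ->
  let phi := fun s => derive1 x s ord0 i in
  [/\ measurable_fun `[a, b] phi,
      exists2 B : R, 0 <= B & forall t, t \in `[a, b] -> `|phi t| <= B &
      forall t, t \in `[a, b] ->
        \int[mu]_(s in `[a, t]) phi s = x t ord0 i - x a ord0 i].
Proof.
move=> ab [xc [s1 dx] pc] phi.
have [[s2 cx] _ _] := pc.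
have [B B0 hB] := piecewise_continuous_bounded pc.
have cphi t : t \in `]a, b[ -> t \notin s2 -> {for t, continuous phi}.
  move=> tab ts; apply: (@continuous_comp _ _ _ (derive1 x) (fun M : 'rV[R]_n => M ord0 i)).
    exact: cx.
  exact: coord_continuous.
have mphi := measurable_continuous_off_finite cphi.
have bphi t : t \in `[a, b] -> `|phi t| <= B.
  by move=> tab; apply: le_trans (hB t tab); exact: normr_entry_le.
split => //; first by exists B.
move=> t tab; have [at_ tb] : a <= t /\ t <= b.
  by move: tab; rewrite in_itv/= => /andP[].
have sub : `[a, t]%classic `<=` `[a, b]%classic.
  by apply: subset_itvl; rewrite bnd_simp.
have iphi : mu.-integrable `[a, t] (EFin \o phi).
  apply: measurable_bounded_integrable => //.
  - exact: (compact_finite_measure (@segment_compact R a t)).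
  - exact: measurable_funS mphi.
  - exists B; split; first exact: num_real.
    by move=> M BM u /= uat; apply: le_trans (ltW BM); apply: bphi; exact: sub.
apply: (@FTC_finite_exceptions R (s1 ++ s2) phi (fun u => x u ord0 i)) => //.
- move=> u; apply: (@continuous_comp (subspace `[a, t]) _ _ x (fun M : 'rV[R]_n => M ord0 i)).
    exact: (continuous_subspaceW sub xc).
  exact: coord_continuous.
- move=> u uat; rewrite mem_cat negb_or => /andP[us1 us2].
  have uab : u \in `]a, b[.
    by move: uat; rewrite !in_itv/= => /andP[-> ut]; rewrite (lt_le_trans ut).
  split; first exact: cphi.
  have dxu := dx u uab us1.
  split; first exact: (derivable_mxP _ _ _).1.
  by rewrite /phi derive1E derive_mx// mxE.
Qed.

End piecewise.

(** * Inversion of the Caputo equation into a Volterra equation *)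

Section volterra.
Context {R : realType}.
Notation mu := (@lebesgue_measure R).

Lemma cintegrable_fubini_F (H : R * R -> R[i]) : cintegrable (mu \x mu)%E H ->
  (forall x, cintegrable mu (fun y => H (x, y))) ->
  cintegrable mu (fun x => cintegral setT (fun y => H (x, y))).
Proof.
move=> [h1 h2] hH; split.
- have := integrable_fubini_F h1; apply: eq_integrable => // x _.
  by rewrite /fubini_F/= /Rintegral fineK//; apply: integrable_fin_num => //; case: (hH x).
- have := integrable_fubini_F h2; apply: eq_integrable => // x _.
  by rewrite /fubini_F/= /Rintegral fineK//; apply: integrable_fin_num => //; case: (hH x).
Qed.

Lemma Gamma0 : Gamma (0 : R[i]) = 0.
Proof.
rewrite /Gamma [complex.Re 0]/= ltxx big_ord_recl addr0 mul0r.
by rewrite invr0 mulr0.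
Qed.

(** At alpha = 0 or 1 the identity of index 0 contains the factor Gamma 0, whose value is 0 by
    convention, and would read 0 = 1. *)
Lemma Gamma_inverse_order_open (alpha : R) (beta : R[i]) (a b : nat -> R[i]) :
  0 <= alpha <= 1 -> Gamma_inverse alpha beta a b -> 0 < alpha < 1.
Proof.
move=> /andP[a0 a1] /(_ 0%N); rewrite big_ord_recl big_ord0 addr0/= /Gamma_coef !mulr0 !add0r => h.
rewrite !lt_neqAle a0 a1 !andbT; apply/andP; split; apply/eqP => e.
- move/eqP: h; rewrite -e Gamma0 mulr0 mul0r eq_sym.
  by rewrite oner_eq0.
- move/eqP: h; rewrite e subrr Gamma0 !mulr0 eq_sym.
  by rewrite oner_eq0.
Qed.

Variables (a b alpha : R) (beta : R[i]).
Hypotheses (ab : a < b) (alpha01 : 0 < alpha < 1) (beta0 : 0 <= complex.Re beta).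
Variables (rho rho' : R) (A Abar : R[i] -> R[i]) (ca cabar : nat -> R[i]).
Hypotheses (hrho : (b - a) `^ complex.Re beta < rho) (hA : power_series_on rho ca A).
Hypotheses (hrho' : (b - a) `^ complex.Re beta < rho') (hAbar : power_series_on rho' cabar Abar).
Hypothesis hinv : Gamma_inverse alpha beta ca cabar.

Let l0 : 0 < b - a. Proof. by rewrite subr_gt0. Qed.
Let alpha0 : 0 < alpha. Proof. by case/andP : alpha01. Qed.
Let alpha1 : 0 < 1 - alpha. Proof. by case/andP : alpha01; rewrite subr_gt0. Qed.

Local Notation k := (kernel beta (b - a) alpha A).
Local Notation kbar := (kernel beta (b - a) (1 - alpha) Abar).

Let ik : cintegrable mu k. Proof. exact: (cintegrable_kernel beta0 l0 alpha0 hrho hA). Qed.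
Let ikbar : cintegrable mu kbar. Proof. exact: (cintegrable_kernel beta0 l0 alpha1 hrho' hAbar). Qed.

Let k_le0 v : v <= 0 -> k v = 0.
Proof. by move=> v0; rewrite /kernel ltNge v0. Qed.

Let kbar_le0 v : v <= 0 -> kbar v = 0.
Proof. by move=> v0; rewrite /kernel ltNge v0. Qed.

(** The point t is left out because [kernel_convolution] needs s < t. *)
Let restrict_path (t : R) (phi : R -> R) s : R := if a <= s < t then phi s else 0.

Let frac_integralE (phi : R -> R) (t u : R) : a <= u -> u < t -> t <= b ->
  cintegral setT (fun s => kbar (u - s) * (restrict_path t phi s)%:C) =
  frac_integral a (1 - alpha) beta Abar phi u.
Proof.
move=> au ut tb; rewrite /frac_integral [RHS]cintegral_mkcond; apply: eq_cintegral => s _.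
have -> : (s \in `[a, u]%classic) = (a <= s <= u).
  by apply/idP/idP; rewrite inE/= in_itv/=.
rewrite /restrict_path; have [as_|sa] := leP a s; last by rewrite mulr0.
have [su|us] := leP s u; last by rewrite kbar_le0 ?mul0r// subr_le0 ltW.
rewrite (le_lt_trans su ut)/=; congr (_ * _).
(* At s = u both sides vanish: the kernel by its cut-off, the power because 0 to the nonzero
   exponent -alpha is 0. *)
move: su; rewrite le_eqVlt => /predU1P[->|su].
  rewrite kbar_le0 ?subrr// powR0 ?mul0r//.
  by rewrite addrAC subrr sub0r oppr_eq0 gt_eqF.
have us0 : 0 < u - s by rewrite subr_gt0.
rewrite /kernel us0 (_ : u - s <= b - a); last by lra.
by rewrite pos_pow_real /rpos_pow us0.
Qed.

(** The function k(t - u) kbar(u - s) phi(s) is integrated in both orders: s first gives k(t - u)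
    g(u), u first gives phi(s). As [g] is known only through the inner integral, its integrability
    against k also comes from Fubini. *)
Lemma volterra_inversion (phi g : R -> R) (t B : R) : t \in `[a, b] ->
  measurable_fun `[a, b] phi -> (forall s, s \in `[a, b] -> `|phi s| <= B) ->
  (forall u, u \in `[a, b] -> frac_integral a (1 - alpha) beta Abar phi u = (g u)%:C) ->
  cintegrable mu (fun u => k (t - u) * (if a <= u <= b then g u else 0)%:C) /\
  cintegral setT (fun u => k (t - u) * (if a <= u <= b then g u else 0)%:C) =
    (\int[mu]_(s in `[a, t]) phi s)%:C.
Proof.
rewrite in_itv/= => /andP[at_ tb] mphi phiB hg.
have B0 : 0 <= B.
  by apply: le_trans (phiB a _); rewrite ?normr_ge0// in_itv/= lexx ltW.
pose psi := restrict_path t phi.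
have psiB s : `|psi s| <= B.
  rewrite /psi /restrict_path; case: ifPn => [/andP[as_ st]|_]; last by rewrite normr0.
  by apply: phiB; rewrite in_itv/= as_/=; exact: le_trans (ltW st) tb.
have mpsi : measurable_fun setT psi.
  rewrite (_ : psi = phi \_ `[a, t[); last first.
    apply/funext => s; rewrite patchE /psi /restrict_path.
    have -> // : (s \in `[a, t[%classic) = (a <= s < t).
    by apply/idP/idP; rewrite inE/= in_itv/=.
  apply/(measurable_restrictT _ _).1 => //; apply: (measurable_funS _ _ mphi) => //.
  by apply: subset_itvl; rewrite bnd_simp.
(* [G] is reflected so that kbar(u - s) reads G(s - u), the form required by
   [cintegrable_convolution]. *)
pose F u := k (t - u); pose G v := kbar (0 - v).
have iF : cintegrable mu F := cintegrable_reflect t ik.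
have iG : cintegrable mu G := cintegrable_reflect 0 ikbar.
pose H (p : R * R) := F p.1 * (G (p.2 - p.1) * (psi p.2)%:C).
have mH : cmeasurable H.
  apply: cmeasurableM.
    by apply: (cmeasurable_comp (g := F)) => //; exact: cintegrable_cmeasurable.
  apply: cmeasurableM.
    apply: (cmeasurable_comp (g := G)); first exact: cintegrable_cmeasurable.
    exact: measurable_funB.
  by apply: cmeasurable_real; exact: (measurableT_comp mpsi).
have iH : cintegrable (mu \x mu)%E H.
  apply: (cintegrable_convolution (F := F) (G := G) (B := B)) => //.
  move=> u s; rewrite /H/= !normcM normc_real mulrA mulrC ler_wpM2r//.
  by rewrite mulr_ge0 ?normc_ge0.
have iGpsi u : cintegrable mu (fun s => kbar (u - s) * (psi s)%:C).
  have iu := cintegrable_reflect u ikbar.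
  apply: (@cintegrable_le _ _ _ mu _ (fun s => B * normc (kbar (u - s)))).
  - apply: cmeasurableM; first exact: cintegrable_cmeasurable.
    exact: cmeasurable_real.
  - exact: (integrableZl measurableT B (integrable_normc iu)).
  - by move=> s; rewrite normcM normc_real mulrC ler_wpM2r ?normc_ge0.
have HE u s : H (u, s) = k (t - u) * (kbar (u - s) * (psi s)%:C).
  by rewrite /H/= /F /G sub0r opprB.
have IE u : cintegral setT (fun s => H (u, s)) =
    k (t - u) * (if a <= u <= b then g u else 0)%:C.
  rewrite (eq_cintegral (h := fun s => k (t - u) * (kbar (u - s) * (psi s)%:C))); last by move=> s _; exact: HE.
  rewrite cintegralZl//.
  have [tu|ut] := leP t u; first by rewrite k_le0 ?mul0r// subr_le0.
  have [au|ua] := leP a u; last first.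
    congr (_ * _); rewrite -[RHS](@cintegral0 R); apply: eq_cintegral => s _.
    rewrite /psi /restrict_path; case: ifPn => [/andP[as_ _]|_]; last by rewrite mulr0.
    by rewrite kbar_le0 ?mul0r// subr_le0 (le_trans (ltW ua)).
  have ub : u <= b by exact: le_trans (ltW ut) tb.
  by rewrite ub /= frac_integralE// hg// in_itv/= au.
split.
  under eq_fun do rewrite -IE.
  apply: cintegrable_fubini_F => // u.
  by under eq_fun do rewrite HE; exact: cintegrableZl.
under eq_fun do rewrite -IE.
rewrite cintegral_Fubini//.
have JE s : cintegral setT (fun u => H (u, s)) = (psi s)%:C.
  rewrite (eq_cintegral (h := fun u => (psi s)%:C * (k (t - u) * kbar (u - s)))); last first.
    by move=> u _; rewrite HE; ring.
  rewrite {1 2}/psi /restrict_path; case: ifPn => [/andP[as_ st]|_]; last first.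
    by rewrite -[RHS](@cintegral0 R); apply: eq_cintegral => u _; rewrite mul0r.
  have tsl : t - s <= b - a by lra.
  have [i1 e1] := kernel_convolution beta0 l0 alpha01 hrho hrho' hA hAbar hinv st tsl.
  by rewrite cintegralZl// [cintegral _ _]e1 mulr1.
rewrite (eq_cintegral (h := fun s => (psi s)%:C)); last by move=> s _; exact: JE.
rewrite cintegral_real; congr (_%:C).
have iphi : mu.-integrable `[a, t] (EFin \o phi).
  apply: measurable_bounded_integrable => //.
  - exact: (compact_finite_measure (@segment_compact R a t)).
  - apply: (measurable_funS _ _ mphi) => //; by apply: subset_itvl; rewrite bnd_simp.
  - exists B; split; first exact: num_real.
    move=> M BM s /=; rewrite in_itv/= => /andP[as_ st].
    by apply: le_trans (ltW BM); apply: phiB; rewrite in_itv/= as_ (le_trans st).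
rewrite -Rintegral_itv_bndo_bndc; last first.
  by apply: integrableS iphi => //; apply: subset_itvl; rewrite bnd_simp.
rewrite [RHS]Rintegral_mkcond; apply: eq_Rintegral => s _.
rewrite patchE /psi /restrict_path.
have -> // : (s \in `[a, t[%classic) = (a <= s < t).
by apply/idP/idP; rewrite inE/= in_itv/=.
Qed.

Lemma trajectory_volterra (n m : nat) (f : R -> 'rV[R]_n -> 'rV[R]_m -> 'rV[R]_n)
    (xa : 'rV[R]_n) (u : R -> 'rV[R]_m) (x : R -> 'rV[R]_n) (i : 'I_n) (t : R) :
  trajectory a b alpha beta Abar f xa u x -> t \in `[a, b] ->
  let g r := (if a <= r <= b then f r (x r) (u r) ord0 i else 0) : R in
  cintegrable mu (fun r => k (t - r) * (g r)%:C) /\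
  cintegral setT (fun r => k (t - r) * (g r)%:C) = (x t ord0 i - xa ord0 i)%:C.
Proof.
move=> [xC1 xE x0] tab g; have [mphi [B _ hB] FTC] := piecewise_C1_coord i ab xC1.
rewrite -x0 -FTC//.
apply: (volterra_inversion (g := fun r => f r (x r) (u r) ord0 i) tab mphi hB).
by move=> r /xE /rowP /(_ i); rewrite !mxE.
Qed.

End volterra.

(** * A Gronwall estimate for weakly singular kernels *)

Section gronwall.
Context {R : realType}.
Notation mu := (@lebesgue_measure R).

Lemma Rintegral_rpos_pow_expR (alpha lambda : R) : 0 < alpha -> 0 < lambda ->
  mu.-integrable setT (EFin \o (fun v => rpos_pow alpha v * expR (- (lambda * v)))) /\
  \int[mu]_v (rpos_pow alpha v * expR (- (lambda * v))) =
    lambda `^ (- alpha) * rGamma alpha.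
Proof.
move=> alpha0 lambda0.
have i := integrable_rpos_powR_expR alpha0.
have E v : rpos_pow alpha v * expR (- (lambda * v)) =
    lambda `^ (1 - alpha) * (rpos_pow alpha (0 + lambda * v) * expR (- (0 + lambda * v))).
  rewrite add0r mulrA; congr (_ * _); rewrite /rpos_pow pmulr_rgt0//.
  case: ifPn => v0; last by rewrite mulr0.
  rewrite powRM ?(ltW lambda0) ?(ltW v0)// mulrA -powRD; last by rewrite (gt_eqF lambda0) implybT.
  have -> : 1 - alpha + (alpha - 1) = 0 by ring.
  by rewrite powRr0 mul1r.
have i' := integrable_affine 0 lambda0 i.
have i2 : mu.-integrable setT (EFin \o (fun v => lambda `^ (1 - alpha) *
    (rpos_pow alpha (0 + lambda * v) * expR (- (0 + lambda * v))))).
  exact: (integrableZl measurableT (lambda `^ (1 - alpha)) i').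
split; first by apply: eq_integrable i2 => // v _ /=; rewrite E.
under eq_Rintegral do rewrite E.
rewrite RintegralZl// /rGamma -(Rintegral_affine 0 lambda0 i) mulrA; congr (_ * _).
rewrite -[X in _ = _ * X](powRr1 (ltW lambda0)) -powRD; last by rewrite (gt_eqF lambda0) implybT.
by congr (_ `^ _); ring.
Qed.

(** [K] is chosen before [E], [y] and [d], so a single constant serves all values of eps. *)
Lemma volterra_gronwall (n : nat) (a b alpha C L : R) (k : R -> R[i]) :
  a < b -> 0 < alpha -> 0 <= C -> 0 <= L ->
  (forall v, normc (k v) <= C * rpos_pow alpha v) ->
  exists K : R, forall (E : R) (y : R -> 'rV[R]_n) (d : 'I_n -> R -> R),
    0 <= E -> {within `[a, b], continuous y} ->
    (forall i r, `|d i r| <= if a <= r <= b then L * `|y r| + E else 0) ->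
    (forall i t, t \in `[a, b] ->
      cintegrable mu (fun r => k (t - r) * (d i r)%:C) /\
      cintegral setT (fun r => k (t - r) * (d i r)%:C) = (y t ord0 i)%:C) ->
    forall t, t \in `[a, b] -> `|y t| <= K * E.
Proof.
move=> ab alpha0 C0 L0 kC.
have G0 := rGamma_gt0 alpha0; set Gam := rGamma alpha in G0.
(* Chosen for [kappaL]: with lambda^(-alpha) = 1/q, the weighted kernel contributes at most 2 C Gam
   / q, and the 4 makes its product with L at most 1/2. *)
pose q := 4 * C * Gam * L + 1.
have CGL : 0 <= C * Gam * L by rewrite !mulr_ge0// ltW.
have q0 : 0 < q by rewrite /q; lra.
pose lambda := q `^ alpha^-1.
have lambda0 : 0 < lambda by exact: powR_gt0.
have lambdaE : lambda `^ (- alpha) = q^-1.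
  by rewrite /lambda -powRrM mulrN mulVf ?gt_eqF// powR_inv1// ltW.
pose kappa := 2 * C * (q^-1 * Gam).
have kappa0 : 0 <= kappa by rewrite !mulr_ge0 ?invr_ge0// ltW.
have kappaL : kappa * L <= 2^-1.
  rewrite /kappa (_ : _ * L = (2 * (C * Gam * L)) / q); last by ring.
  by rewrite ler_pdivrMr// /q; lra.
exists (2 * kappa * expR (lambda * (b - a))) => E y d E0 yc dle hy t tab.
have [iP eP] := Rintegral_rpos_pow_expR alpha0 lambda0.
pose w r := expR (- (lambda * (r - a))) * `|y r|.
have wc : {within `[a, b], continuous w}.
  move=> u; apply: cvgM; last by apply: cvg_norm; exact: yc.
  apply: continuous_subspaceT => r.
  apply: (continuous_comp (f := fun r : R => - (lambda * (r - a))) (g := @expR R)); last exact: continuous_expR.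
  by apply: cvgN; apply: cvgM; [exact: cvg_cst|apply: cvgB; [exact: cvg_id|exact: cvg_cst]].
(* The weighted supremum is attained, so the integral equation has to be estimated at [t0] only. *)
have [t0 t0ab wmax] := EVT_max (ltW ab) wc.
set M := w t0 in wmax.
have yM r : r \in `[a, b] -> `|y r| <= M * expR (lambda * (r - a)).
  by move=> /wmax; rewrite /w expRN mulrC ler_pdivrMr ?expR_gt0.
have M0 : 0 <= M by rewrite mulr_ge0 ?expR_ge0.
pose D := L * M + E.
have D0 : 0 <= D by rewrite addr_ge0 ?mulr_ge0.
have yt0 : `|y t0| <= kappa * D * expR (lambda * (t0 - a)).
  apply: normr_row_le => [|i]; first by rewrite mulr_ge0 ?expR_ge0// mulr_ge0.
  have [ih eh] := hy i t0 t0ab.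
  rewrite -normc_real -eh.
  pose P v := rpos_pow alpha v * expR (- (lambda * v)).
  pose c := C * D * expR (lambda * (t0 - a)).
  have iPr : mu.-integrable setT (EFin \o (fun r => c * P (t0 - r))) :=
    integrableZl measurableT c (integrable_reflect t0 iP).
  apply: le_trans (normc_cintegral_le ih iPr _) _.
    move=> r; rewrite normcM normc_real.
    (* The growing weight at r splits into the constant weight at [t0] and the decaying factor
       integrated by [eP]. *)
    have -> : c * P (t0 - r) = C * rpos_pow alpha (t0 - r) * (D * expR (lambda * (r - a))).
      rewrite /c /P (_ : lambda * (r - a) = lambda * (t0 - a) + - (lambda * (t0 - r))); last by ring.
      by rewrite expRD; ring.
    apply: ler_pM; rewrite ?normc_ge0//; apply: le_trans (dle i r) _.
    case: ifPn => rab; last by rewrite mulr_ge0 ?expR_ge0.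
    have e1 : 1 <= expR (lambda * (r - a)).
      rewrite -[leLHS]expR0 ler_expR mulr_ge0 ?(ltW lambda0)// subr_ge0.
      by case/andP : rab.
    have := yM r; rewrite in_itv/= rab => /(_ isT) /(ler_wpM2l L0) h.
    have := ler_peMr E0 e1; rewrite /D; lra.
  rewrite RintegralZl ?(integrable_reflect t0 iP)// (Rintegral_reflect t0 iP) eP lambdaE.
  by rewrite le_eqVlt; apply/orP; left; apply/eqP; rewrite /c /kappa -/Gam; ring.
have MD : M <= kappa * D.
  by rewrite /M /w expRN mulrC ler_pdivrMr ?expR_gt0.
(* M <= kappa (L M + E) <= M/2 + kappa E, and M/2 is absorbed on the left. *)
have {MD} ME : M <= 2 * kappa * E.
  have := ler_wpM2r M0 kappaL; move: MD; rewrite /D; lra.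
apply: le_trans (yM t tab) _.
rewrite [leRHS](_ : _ = 2 * kappa * E * expR (lambda * (b - a))); last by ring.
apply: ler_pM; rewrite ?expR_ge0// ler_expR ler_wpM2l ?(ltW lambda0)// lerB//.
by move: tab; rewrite in_itv/= => /andP[].
Qed.

End gronwall.

(** * Continuous dependence of the trajectory on eps *)

Lemma lipschitz_rowP (R : realType) (p q : nat) (L : R) (F : 'rV[R]_p -> 'rV[R]_q) :
  L.-lipschitz F -> forall x y, `|F x - F y| <= L * `|x - y|.
Proof. by move=> FL x y; exact: (FL (x, y)). Qed.

Theorem lemma13 (R : realType) (n m : nat) (hmn : (m <= n)%N)
  (a b : R) (hab : a < b)
  (alpha : R) (halpha : 0 <= alpha <= 1)
  (beta : R[i]) (hbeta : 0 <= complex.Re beta)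
  (rho : R) (hrho0 : 0 < rho) (hrho : (b - a) `^ complex.Re beta < rho)
  (A : R[i] -> R[i]) (ca : nat -> R[i]) (hA : power_series_on rho ca A)
  (rhobar : R) (hrhobar : (b - a) `^ complex.Re beta < rhobar)
  (Abar : R[i] -> R[i]) (cabar : nat -> R[i])
  (hAbar : power_series_on rhobar cabar Abar)
  (hinv : Gamma_inverse alpha beta ca cabar)
  (f : R -> 'rV[R]_n -> 'rV[R]_m -> 'rV[R]_n)
  (hfC1 : C1_on [set p : R * 'rV[R]_n * 'rV[R]_m | p.1.1 \in `[a, b]]
                (fun p => f p.1.1 p.1.2 p.2))
  (hfx : exists L : R, forall t u, t \in `[a, b] ->
           L.-lipschitz (fun x => f t x u))
  (hfu : exists L : R, forall t x, t \in `[a, b] ->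
           L.-lipschitz (fun u => f t x u))
  (xa : 'rV[R]_n)
  (ustar : R -> 'rV[R]_m) (hustar : piecewise_continuous a b ustar)
  (xstar : R -> 'rV[R]_n)
  (hxstar : trajectory a b alpha beta Abar f xa ustar xstar)
  (h : R -> 'rV[R]_m) (hh : piecewise_continuous a b h)
  (xeps : R -> R -> 'rV[R]_n)
  (hxeps : forall eps : R,
     trajectory a b alpha beta Abar f xa
       (fun t => ustar t + eps *: h t) (xeps eps)) :
  forall t : R, t \in `[a, b] -> xeps eps t @[eps --> 0^'] --> xstar t.
Proof.
have alpha01 := Gamma_inverse_order_open halpha hinv.
have /andP[alpha0 _] := alpha01.
have [Lx hLx] := hfx; have [Lu hLu] := hfu.
have [B B0 hB] := piecewise_continuous_bounded hh.
have [C C0 hC] : exists2 C : R, 0 <= C & forall v,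
    normc (kernel beta (b - a) alpha A v) <= C * rpos_pow alpha v.
  have l0 : 0 < b - a by rewrite subr_gt0.
  have [C C0 hC] := kernel_le hbeta l0 alpha hrho hA.
  exists C => // v; apply: le_trans (hC v) _; rewrite ler_wpM2l//.
  by case: ifP => // _; exact: rpos_pow_ge0.
(* The absolute value is taken because a Lipschitz constant is given without a sign. *)
have [K hK] := volterra_gronwall n hab alpha0 C0 (normr_ge0 Lx) hC.
have bound eps t : t \in `[a, b] -> `|xeps eps t - xstar t| <= K * (`|Lu| * (`|eps| * B)).
  pose g (u : R -> 'rV[R]_m) (x : R -> 'rV[R]_n) i r : R :=
    if a <= r <= b then f r (x r) (u r) ord0 i else 0.
  pose ueps r := ustar r + eps *: h r.
  apply: (hK _ (fun r => xeps eps r - xstar r)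
    (fun i r => g ueps (xeps eps) i r - g ustar xstar i r)).
  - by rewrite !mulr_ge0.
  - have [[c1 _ _] _ _] := hxeps eps; have [[c2 _ _] _ _] := hxstar.
    by move=> r; apply: cvgB; [exact: c1|exact: c2].
  - move=> i r; rewrite /g; case: ifPn => rab; last by rewrite subrr normr0.
    have rI : r \in `[a, b] by rewrite in_itv.
    (* Changing the state first and the control afterwards separates the Gronwall term from the
       perturbation of size |eps|. *)
    have -> : f r (xeps eps r) (ueps r) ord0 i - f r (xstar r) (ustar r) ord0 i =
      ((f r (xeps eps r) (ueps r) - f r (xstar r) (ueps r)) +
       (f r (xstar r) (ueps r) - f r (xstar r) (ustar r))) ord0 i.
      by rewrite !mxE; ring.
    apply: le_trans (normr_entry_le _ _) _; apply: le_trans (ler_normD _ _) _.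
    apply: lerD.
      apply: le_trans (lipschitz_rowP (hLx r (ueps r) rI) _ _) _.
      by rewrite ler_wpM2r// ler_norm.
    apply: le_trans (lipschitz_rowP (hLu r (xstar r) rI) _ _) _.
    rewrite /ueps addrAC subrr add0r normrZ.
    apply: (@le_trans _ _ (`|Lu| * (`|eps| * `|h r|))).
      by rewrite ler_wpM2r ?mulr_ge0// ler_norm.
    by rewrite !ler_wpM2l// hB.
  - move=> i r rI.
    have [i1 e1] := trajectory_volterra hab alpha01 hbeta hrho hA hrhobar hAbar hinv i (hxeps eps) rI.
    have [i2 e2] := trajectory_volterra hab alpha01 hbeta hrho hA hrhobar hAbar hinv i hxstar rI.
    have E s : kernel beta (b - a) alpha A (r - s) * (g ueps (xeps eps) i s - g ustar xstar i s)%:C =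
      kernel beta (b - a) alpha A (r - s) * (g ueps (xeps eps) i s)%:C +
      (-1) * (kernel beta (b - a) alpha A (r - s) * (g ustar xstar i s)%:C).
      by rewrite rmorphB/=; ring.
    under eq_fun do rewrite E; split.
      exact: (cintegrableD i1 (cintegrableZl (-1) i2)).
    rewrite (cintegralD i1 (cintegrableZl (-1) i2)) cintegralZl// [cintegral _ _]e1 [cintegral _ _]e2.
    rewrite !mxE mulN1r -rmorphB/=; congr (_%:C); ring.
move=> t tab; apply/cvgrPdist_le => e e0.
(* The added 1 makes [c] positive, so that e / c is a valid threshold for |eps|. *)
pose c := `|K| * (`|Lu| * B) + 1.
have c0 : 0 < c by rewrite ltr_wpDl// !mulr_ge0.
near=> eps.
rewrite distrC; apply: le_trans (bound eps t tab) _.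
apply: (@le_trans _ _ (c * `|eps|)).
  rewrite (_ : K * _ = K * (`|Lu| * B) * `|eps|); last by ring.
  rewrite ler_wpM2r// /c; apply: (@le_trans _ _ (`|K| * (`|Lu| * B))).
    by rewrite ler_wpM2r ?mulr_ge0// ler_norm.
  by rewrite lerDl.
rewrite mulrC -ler_pdivlMr//; apply: ltW.
by near: eps; apply: dnbhs0_lt; exact: divr_gt0.
Unshelve. all: by end_near. Qed.
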